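(* There are absolute constants $c_3,C>0$ such that the following holds. Let $d\ge2$ and suppose $|a+b|<\epsilon^5$. Let $\alpha_3=-c_3\epsilon^2$. Then the top two eigenvalues $\lambda_1\ge\lambda_2$ of the re-weighted (uncentered) covariance $\mathbb{E}_{x\sim P}\,e^{\alpha_3\|x\|^2}xx^\top$ of $P$ satisfy $$\lambda_1-\lambda_2\ge C\epsilon^3\lambda_1.$$ Moreover, its top eigenvector is $u$ (up to sign).
   Context: Let $\epsilon>0$ and let $q$ be a symmetric (about $0$) one-dimensional isotropic (mean $0$, variance $1$) logconcave density. Let $a<b$ satisfy $q((-\infty,a])\ge\epsilon$, $q([a,b])\ge\epsilon$, $q([b,\infty))\ge\epsilon$, where $q(I)=\int_I q$. Let $\tilde q$ be $q$ restricted to $\mathbb{R}\setminus[a,b]$ and renormalized, and let $\hat q$ be the isotropized density, i.e. the density of $(X-\mu_1)/\sigma_1$ for $X\sim\tilde q$, where $\mu_1,\sigma_1^2$ are the mean and variance of $\tilde q$. Let $P=\hat q\otimes q\otimes\cdots\otimes q$ on $\mathbb{R}^d$ (one copy of $\hat q$, $d-1$ copies of $q$), and let $u=e_1$ be the unit vector normal to the margin. $\|\cdot\|$ is the Euclidean norm. *)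

(* Defs.v *)
From HB Require Import structures.
From mathcomp Require Import all_boot all_order all_algebra.
From mathcomp Require Import all_classical all_reals all_analysis
  measurable_realfun.

Set Implicit Arguments.
Unset Strict Implicit.
Unset Printing Implicit Defensive.
Import Order.TTheory GRing.Theory Num.Theory.
Import numFieldNormedType.Exports.
Local Open Scope classical_set_scope.
Local Open Scope ring_scope.

Section OneDimensional.
Context {R : realType}.
Implicit Types (q : R -> R) (Q : probability (measurableTypeR R) R).

Definition has_density Q q :=
  [/\ measurable_fun [set: measurableTypeR R] q,
      forall x, 0 <= q x &
      forall A : set (measurableTypeR R), measurable A ->
        Q A = (\int[lebesgue_measure]_(x in A) (q x)%:E)%E].

Definition symmetric_density q := forall x, q (- x) = q x.

(* [0 `^ 0 = 1] and [0 `^ t = 0] for [t != 0], so the inequality is trivial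
   when [t] is 0 or 1 and when [q] vanishes at one of the two points. *)
Definition logconcave q := forall x y t : R, 0 <= t <= 1 ->
  q x `^ t * q y `^ (1 - t) <= q (t * x + (1 - t) * y).

Definition isotropic Q := ('E_Q[idfun] = 0)%E /\ ('V_Q[idfun] = 1)%E.

Lemma measurable_itvccC (a b : R) :
  measurable (~` `[a, b] : set (measurableTypeR R)).
Proof. by apply: measurableC; exact: measurable_itv. Qed.

(* [mnormalize] takes a default value, here [Q], which is only used when the
   restricted measure is null. *)
Definition remove_band Q (a b : R) : probability (measurableTypeR R) R :=
  mnormalize (mrestr Q (measurable_itvccC a b)) Q.

Definition standardize (m s : R) (x : measurableTypeR R) : measurableTypeR R :=
  (x - m) / s.

Lemma measurable_standardize (m s : R) :
  measurable_fun [set: measurableTypeR R] (standardize m s).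
Proof. by apply: measurable_funM => //; exact: measurable_funB. Qed.

HB.instance Definition _ (m s : R) :=
  @isMeasurableFun.Build _ _ (measurableTypeR R) (measurableTypeR R)
    (standardize m s) (measurable_standardize m s).

Definition isotropize Q : probability (measurableTypeR R) R :=
  distribution Q
    (standardize (fine 'E_Q[idfun]%E) (Num.sqrt (fine 'V_Q[idfun]%E))).

End OneDimensional.

Section Product.
Context {R : realType}.

Definition tcons n (z : measurableTypeR R * n.-tuple (measurableTypeR R)) :
  n.+1.-tuple (measurableTypeR R) := [the n.+1.-tuple _ of z.1 :: z.2].

Lemma measurable_tcons n :
  measurable_fun [set: measurableTypeR R * n.-tuple (measurableTypeR R)]
    (@tcons n).
Proof. exact: measurable_cons. Qed.

HB.instance Definition _ n :=
  @isMeasurableFun.Build _ _ _ _ (@tcons n) (@measurable_tcons n).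

Fixpoint prod_prob n (mu : nat -> probability (measurableTypeR R) R) :
    probability (n.-tuple (measurableTypeR R)) R :=
  match n with
  | 0 => dirac [tuple]
  | m.+1 =>
      distribution (mu 0%N \x prod_prob m (fun i => mu i.+1))%E (@tcons m)
  end.

Definition first_other (Qhat Q : probability (measurableTypeR R) R) (i : nat) :=
  if i is 0 then Qhat else Q.

End Product.

Section Spectral.
Context {R : realType}.

(* The norm [`|v|] provided by the library on matrices is the sup norm. *)
Definition enorm d (v : 'cV[R]_d) := Num.sqrt (\sum_i v i 0 ^+ 2).

Definition col_of_tuple d (t : d.-tuple R) : 'cV[R]_d := \col_i tnth t i.

Definition reweight (alpha : R) d (x : 'cV[R]_d) : 'M[R]_d :=
  expR (alpha * enorm x ^+ 2) *: (x *m x^T).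

Definition reweighted_cov d (P : probability (d.-tuple (measurableTypeR R)) R)
    (alpha : R) : 'M[R]_d :=
  \matrix_(i, j) fine 'E_P[fun t => reweight alpha (col_of_tuple t) i j]%E.

(* Eigenvalues are counted with multiplicity. *)
Definition top_two_eigenvalues d (M : 'M[R]_d) (l1 l2 : R) :=
  exists s : seq R,
    char_poly M = \prod_(l <- [:: l1, l2 & s]) ('X - l%:P) /\
    sorted >=%R [:: l1, l2 & s].

Lemma top_two_eigenvalues_unique d (M : 'M[R]_d) (l1 l2 l1' l2' : R) :
  top_two_eigenvalues M l1 l2 -> top_two_eigenvalues M l1' l2' ->
  l1 = l1' /\ l2 = l2'.
Proof.
move=> [s [es ss]] [s' [es' ss']].
have ps : perm_eq [:: l1, l2 & s] [:: l1', l2' & s'].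
  by apply: prod_XsubC_eq; rewrite -es -es'.
have := @sorted_eq _ >=%R ge_trans ge_anti _ _ ss ss' ps.
by case=> -> -> _.
Qed.

Definition e1 d : 'cV[R]_d := \col_i (val i == 0%N)%:R.

End Spectral.

(* Main.v *)
Require Import Defs.
From mathcomp Require Import all_boot all_order all_algebra.
From mathcomp Require Import all_classical all_reals all_analysis.
From mathcomp Require Import measurable_realfun ring lra.
Import Order.TTheory GRing.Theory Num.Theory.
Import numFieldNormedType.Exports.
Local Open Scope classical_set_scope.
Local Open Scope ring_scope.

(* All odd moments of [Q] vanish, so the reweighted covariance is diagonal, with
   entry [N^ D^(d-1)] in the direction [e1] and [D^ N D^(d-2)] in the others,
   where [N = E x^2 e^(-beta x^2)] and [D = E e^(-beta x^2)] under [q], and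
   [N^, D^] are the same quantities under [q^].  To first order in [beta],
   [N^ D - N D^] is [beta] times the drop of the fourth moment from [q] to [q^].
   For a symmetric band [-t, t] this drop is of order [eps]: for [t <= 1/2] it is
   read off the moments, and the kurtosis of [q] restricted to [|x| > t] is
   nonincreasing in [t], because two such laws rescaled to unit variance have
   densities whose difference changes sign at most twice on the half line.  The
   asymmetry [|a + b| < eps^5] only perturbs the kurtosis to second order, that
   is by [O(eps^8)], which leaves the drop positive up to [eps = 1/3]. *)

(** The terms of second order in [beta] must be beaten with absolute constants. The inequality
    [1 - u <= e^(-u)] bounds [N^] and [D] from below with moments up to the fourth, and
    [e^(-u) <= 1 - u + u^2] bounds [N] and [D^] from above. A sixth moment is thus needed only for
    [q], where log-concavity bounds it by an absolute [S], and never for [q^]. The remainder is at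
    most [beta^2 (1 + 3 S)]. With [beta = c3 eps^2] and [c3 (1 + 3 S) = 1/40] it is
    [beta eps^2 / 40], at most half of the gain [beta eps / 20]; what is left is [beta eps / 40],
    whence [C = c3 / 40]. Monotonicity alone gives no strict drop of the kurtosis: it carries to all
    [t > 1/2] the drop already won at [t = 1/2], which is bounded below because [q] puts mass at
    least 3/16 on [[-1/2, 1/2]]. The relative drop is 3/32 of the mass for a symmetric band,
    [9 eps / 100] for each of the two tails of the actual band, and [eps / 20] once mixing the tails
    and recentering are paid for. *)

Local Notation leb := (@lebesgue_measure _).
Local Notation integ f := (leb.-integrable setT (EFin \o f)).
Local Notation lint f := (\int[leb]_x f x).

(** * Integration against a density *)

Section Densities.
Context {R : realType}.
Implicit Types (f g q : R -> R) (Q : probability (measurableTypeR R) R).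

Lemma density_integrable Q q : has_density Q q ->
  leb.-integrable setT (EFin \o q).
Proof.
move=> [mq q0 Qq]; apply/integrableP; split; first exact/measurable_EFinP.
under eq_integral do rewrite gee0_abs ?lee_fin ?q0//.
by rewrite -Qq// probability_setT ltry.
Qed.

(** The function [q] and the Radon-Nikodym derivative of [Q] have the same integral over every
    measurable set, so they agree almost everywhere, and the change of variables for the derivative
    transfers to [q]. *)
Lemma ge0_integral_density Q q (f : R -> \bar R) : has_density Q q ->
  measurable_fun [set: measurableTypeR R] f -> (forall x, 0 <= f x)%E ->
  (\int[Q]_x f x = \int[leb]_x (f x * (q x)%:E))%E.
Proof.
move=> dq; have iq := density_integrable _ _ dq; case: dq => mq q0 Qq mf f0.
have Qleb : Q `<< leb.
  apply/null_content_dominatesP => N mN N0.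
  by rewrite Qq// null_set_integral//; exact/measurable_funTS/measurable_EFinP.
rewrite -(Radon_Nikodym_SigmaFinite.change_of_variables Qleb)//.
have mRN := Radon_Nikodym_SigmaFinite.f_integrable Qleb.
apply: ae_eq_integral => //.
- by apply: emeasurable_funM => //; exact: measurable_int mRN.
- by apply: emeasurable_funM => //; exact/measurable_EFinP.
apply: ae_eqe_mul2l.
apply: integral_ae_eq => //; first exact/measurable_EFinP.
move=> E _ mE.
by rewrite -Qq// (Radon_Nikodym_SigmaFinite.f_integral Qleb).
Qed.

Lemma measurable_affine (s h : R) :
  measurable_fun setT (fun x : measurableTypeR R => s * x + h : measurableTypeR R).
Proof. by apply: measurable_funD => //; exact: measurable_funM. Qed.

(** Lebesgue measure is [s] times its image under [x -> s x + h]; by uniqueness it suffices to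
    compare the two on intervals []a, b]]. *)
Lemma ge0_integral_affine (s h : R) (f : R -> \bar R) : 0 < s ->
  measurable_fun [set: measurableTypeR R] f -> (forall x, 0 <= f x)%E ->
  (\int[leb]_x f x = s%:E * \int[leb]_x f (s * x + h)%R)%E.
Proof.
move=> s0 mf f0.
pose phi := fun x : measurableTypeR R => s * x + h : measurableTypeR R.
have mphi : measurable_fun setT phi := measurable_affine s h.
pose s' : {nonneg R} := NngNum (ltW s0).
pose nu' : {measure set (measurableTypeR R) -> \bar R} :=
  mscale s' (pushforward leb phi).
pose nu := nu' mphi.
have E : forall A, measurable A -> leb A = nu A.
  apply: lebesgue_measure_unique => X [[a b] _ <-] /=.
  have phiE : phi @^-1` `]a, b] = `](a - h) / s, (b - h) / s]%classic.
    apply/seteqP; split => x /=; rewrite !in_itv/= /phi;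
      by rewrite ltr_pdivrMr// ler_pdivlMr// ltrBlDr lerBrDr mulrC.
  rewrite -[RHS]/(s%:E * leb (phi @^-1` `]a, b]))%E phiE.
  rewrite !lebesgue_measure_itv/= !lte_fin ltr_pM2r ?invr_gt0// ltrD2r.
  case: ifPn => ab; last by rewrite mule0.
  rewrite -!EFinD -EFinM; congr EFin; field.
  by rewrite gt_eqF.
have -> : (\int[leb]_x f x = \int[nu]_x f x)%E.
  by apply: eq_measure_integral => A mA _; exact: E.
rewrite ge0_integral_mscale//; congr (_ * _)%E.
by rewrite (ge0_integral_pushforward mphi).
Qed.

Lemma ge0_integral_opp (f : R -> \bar R) :
  measurable_fun [set: measurableTypeR R] f -> (forall x, 0 <= f x)%E ->
  (\int[leb]_x f x = \int[leb]_x f (- x)%R)%E.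
Proof.
move=> mf f0.
have mopp : measurable_fun setT (-%R : measurableTypeR R -> measurableTypeR R).
  exact: measurable_funN.
have := ge0_integral_pushforward mopp leb measurableT mf (fun y _ => f0 y).
rewrite preimage_setT => <-.
by apply: eq_measure_integral => A mA _; exact/esym/lebesgue_measureN.
Qed.

Lemma integ_dom (f g : R -> R) : measurable_fun setT f ->
  integ g -> (forall x, `|f x| <= g x) -> integ f.
Proof.
move=> mf ig fg; apply: le_integrable ig => //; first exact/measurable_EFinP.
by move=> x _; rewrite lee_fin (le_trans (fg x))// ler_norm.
Qed.

Lemma integ_ge0P (f : R -> R) : measurable_fun setT f -> (forall x, 0 <= f x) ->
  integ f <-> (\int[leb]_x (f x)%:E < +oo)%E.
Proof.
move=> mf f0; split.
  move=> /integrableP[_]; under eq_integral do rewrite gee0_abs ?lee_fin//.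
  by [].
move=> fy; apply/integrableP; split; first exact/measurable_EFinP.
by under eq_integral do rewrite gee0_abs ?lee_fin//.
Qed.

Lemma integ_affine (s h : R) (f : R -> R) : 0 < s ->
  integ f -> integ (fun x => f (s * x + h)).
Proof.
move=> s0 intf; have mf : measurable_fun setT f.
  by apply/measurable_EFinP; exact: measurable_int intf.
move: intf => /integrableP[_ fy]; apply/integrableP; split.
  by apply/measurable_EFinP; apply: measurableT_comp => //; exact: measurable_affine.
move: fy; rewrite (ge0_integral_affine s h)//; last first.
  by apply: measurableT_comp => //; exact/measurable_EFinP.
set J := integral _ _ _ => J1; suff: (J < +oo)%E by [].
have J0 : (0 <= J)%E by exact: integral_ge0.
rewrite ltNge; apply/negP; rewrite leye_eq => /eqP JE.
by move: J1; rewrite JE gt0_muley.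
Qed.

Lemma lint_affine (s h : R) (f : R -> R) : 0 < s ->
  integ f -> lint f = s * lint (fun x => f (s * x + h)).
Proof.
move=> s0 intf; have iaf := integ_affine s h _ s0 intf.
have mf : measurable_fun setT (EFin \o f) := measurable_int _ intf.
have ip := integrable_funepos measurableT intf.
have iN := integrable_funeneg measurableT intf.
have iap := integrable_funepos measurableT iaf.
have iaN := integrable_funeneg measurableT iaf.
have fp : (\int[leb]_x (EFin \o f)^\+ (s * x + h)%R \is a fin_num)%E.
  rewrite (_ : integral _ _ _ = \int[leb]_x (EFin \o (fun x : R => f (s * x + h)%R))^\+ x)%E.
    exact: integrable_fin_num iap.
  by apply: eq_integral => x _; rewrite !funeposE.
have fN : (\int[leb]_x (EFin \o f)^\- (s * x + h)%R \is a fin_num)%E.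
  rewrite (_ : integral _ _ _ = \int[leb]_x (EFin \o (fun x : R => f (s * x + h)%R))^\- x)%E.
    exact: integrable_fin_num iaN.
  by apply: eq_integral => x _; rewrite !funenegE.
have E : (\int[leb]_x (f (s * x + h))%:E = \int[leb]_x (EFin \o f)^\+ (s * x + h)%R
    - \int[leb]_x (EFin \o f)^\- (s * x + h)%R)%E.
  by rewrite [LHS]integralE; congr (_ - _)%E; apply: eq_integral => x _;
    rewrite ?funeposE ?funenegE.
rewrite /Rintegral integralE.
rewrite (ge0_integral_affine s h _ s0 (measurable_funepos mf))//.
rewrite (ge0_integral_affine s h _ s0 (measurable_funeneg mf))//.
rewrite -muleBr//; last by rewrite fin_num_adde_defr.
by rewrite -E fineM// E fin_numB fp fN.
Qed.

Lemma integ_opp (f : R -> R) : integ f -> integ (fun x => f (- x)).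
Proof.
move=> intf; have mf : measurable_fun setT f.
  by apply/measurable_EFinP; exact: measurable_int intf.
move: intf => /integrableP[_ fy]; apply/integrableP; split.
  by apply/measurable_EFinP; apply: measurableT_comp => //; exact: measurable_funN.
move: fy; rewrite ge0_integral_opp//.
by apply: measurableT_comp => //; exact/measurable_EFinP.
Qed.

Lemma lint_opp (f : R -> R) : integ f -> lint f = lint (fun x => f (- x)).
Proof.
move=> intf.
have mf : measurable_fun setT (EFin \o f) := measurable_int _ intf.
rewrite /Rintegral integralE [in RHS]integralE.
rewrite (ge0_integral_opp _ (measurable_funepos mf))//.
rewrite (ge0_integral_opp _ (measurable_funeneg mf))//.
by congr (fine (_ - _)); apply: eq_integral => x _; rewrite ?funeposE ?funenegE.
Qed.

Lemma integ_density Q q f : has_density Q q -> measurable_fun setT f ->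
  integ (fun x => f x * q x) -> Q.-integrable setT (EFin \o f).
Proof.
move=> dq mf /integrableP[_ fy]; have [mq q0 Qq] := dq.
apply/integrableP; split; first exact/measurable_EFinP.
rewrite (ge0_integral_density _ _ _ dq)//; last first.
  by apply: measurableT_comp => //; exact/measurable_EFinP.
apply: le_lt_trans fy; apply: ge0_le_integral => //.
- by move=> x _; rewrite mule_ge0 ?lee_fin.
- apply: emeasurable_funM; last exact/measurable_EFinP.
  by apply: measurableT_comp => //; exact/measurable_EFinP.
- by apply: measurableT_comp => //; apply/measurable_EFinP; exact: measurable_funM.
- by move=> x _; rewrite /= normrM EFinM (ger0_norm (q0 x)).
Qed.

Lemma Rintegral_density Q q f : has_density Q q -> measurable_fun setT f ->
  integ (fun x => f x * q x) -> \int[Q]_x f x = lint (fun x => f x * q x).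
Proof.
move=> dq mf iq; have [mq q0 Qq] := dq.
have iQ := integ_density _ _ _ dq mf iq.
have mf' : measurable_fun setT (EFin \o f) by exact/measurable_EFinP.
rewrite /Rintegral integralE.
rewrite (ge0_integral_density _ _ _ dq (measurable_funepos mf'))//.
rewrite (ge0_integral_density _ _ _ dq (measurable_funeneg mf'))//.
rewrite [in RHS]integralE; congr (fine (_ - _)); apply: eq_integral => x _.
  by rewrite !funeposE /= EFinM maxe_pMl ?lee_fin// mul0e.
by rewrite !funenegE maxe_pMl ?lee_fin// mul0e mulNe.
Qed.

End Densities.

(** * Log-concave densities *)

Section LogConcave.
Context {R : realType}.
Variable q : R -> R.
Hypotheses (q_ge0 : forall x, 0 <= q x) (q_sym : symmetric_density q)
  (q_lc : logconcave q).

(** The inner points [v] and [w] are convex combinations of [u] and [z] with the weights [t],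
    [1 - t] exchanged. In the product of the two log-concavity inequalities, [q u] and [q z] each
    receive total exponent 1. *)
Lemma logconcave_crossing (u v w z : R) : u <= v -> v <= z -> u + z = v + w ->
  q u * q z <= q v * q w.
Proof.
move=> uv vz uzvw.
have [zu|zu] := leP z u.
  have [-> ->] : v = u /\ w = z by split; lra.
  exact: lexx.
(* Exponents are added below only for a nonzero base, so vanishing values are set aside. *)
have [->|qu0] := eqVneq (q u) 0; first by rewrite mul0r mulr_ge0.
have [->|qz0] := eqVneq (q z) 0; first by rewrite mulr0 mulr_ge0.
have zu0 : z - u != 0 by rewrite gt_eqF// subr_gt0.
pose t := (z - v) / (z - u).
have t01 : 0 <= t <= 1.
  by rewrite divr_ge0 ?ler_pdivrMr ?subr_gt0 ?mul1r ?subr_ge0 ?(ltW zu)//= lerB.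
have Ev : t * u + (1 - t) * z = v by rewrite /t; field.
have Ew : t * z + (1 - t) * u = w.
  have -> : w = u + z - v by lra.
  by rewrite /t; field.
have := ler_pM _ _ (q_lc u z t t01) (q_lc z u t t01).
rewrite Ev Ew => /(_ _ _)/(le_trans _); apply; rewrite ?mulr_ge0 ?powR_ge0//.
have pE x : q x != 0 -> q x `^ t * q x `^ (1 - t) = q x.
  by move=> qx; rewrite -powRD ?qx ?implybT// subrKC powRr1.
by rewrite (mulrC (q z `^ t)) mulrACA pE// (mulrC (q z `^ (1 - t))) pE.
Qed.

(** Crossing the outer pair [-y, y] with the inner pair [x, -x] gives, by symmetry, an inequality
    between squares. *)
Lemma logconcave_nincr (x y : R) : 0 <= x <= y -> q y <= q x.
Proof.
move=> /andP[x0 xy].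
have := @logconcave_crossing (- y) x (- x) y.
by rewrite !q_sym addNr subrr -!expr2 ler_sqr ?nnegrE// => ->//; lra.
Qed.

(** Since [s y >= s x + y - x], monotonicity reduces this to the crossing of [x, s x + y - x] with
    [s x, y]. In other terms [q (s x) / q x] is nonincreasing on the half line, which leaves at most
    one sign change between [q] and a multiple of its contraction. *)
Lemma logconcave_scale (s x y : R) : 1 <= s -> 0 <= x <= y ->
  q (s * y) * q x <= q (s * x) * q y.
Proof.
move=> s1 /andP[x0 xy].
have sx : x <= s * x by nra.
apply: (@le_trans _ _ (q x * q (s * x + y - x))).
  rewrite mulrC ler_wpM2l// logconcave_nincr//.
  by apply/andP; split; nra.
by apply: logconcave_crossing; lra.
Qed.

(** The outer pair is [0, x + h], the inner pair [x, h]. A step [h] reduces the density from [x] at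
    least as much as from 0, so one value of [q] controls the decay of the whole tail. *)
Lemma logconcave_translate (x h : R) : 0 <= x -> 0 <= h ->
  q (x + h) * q 0 <= q x * q h.
Proof.
by move=> x0 h0; rewrite mulrC; apply: logconcave_crossing; lra.
Qed.

End LogConcave.

(** Real-valued, so that truncation is a multiplication. The inequality is strict; where closed
    intervals or the origin matter, [lint_point] discards the end point. *)
Definition tail {R : realType} (t x : R) : R := (t < x)%R%:R.

Section Integrals.
Context {R : realType}.
Implicit Types f g : R -> R.

Lemma tail_ge0 (t x : R) : 0 <= tail t x. Proof. exact: ler0n. Qed.

Lemma tail_le1 (t x : R) : tail t x <= 1. Proof. by rewrite /tail lern1 leq_b1. Qed.

Lemma tailE (t : R) : tail t = \1_(`]t, +oo[%classic : set R).
Proof.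
by apply/funext => x; rewrite /tail indicE/= mem_setE in_itv/= andbT.
Qed.

Lemma measurable_tail (t : R) : measurable_fun setT (tail t).
Proof. by rewrite tailE; exact: measurable_indic. Qed.

Lemma lintD f g : integ f -> integ g -> lint (fun x => f x + g x) = lint f + lint g.
Proof. by move=> *; rewrite RintegralD. Qed.

Lemma lintB f g : integ f -> integ g -> lint (fun x => f x - g x) = lint f - lint g.
Proof. by move=> *; rewrite RintegralB. Qed.

Lemma lintZ (c : R) f : integ f -> lint (fun x => c * f x) = c * lint f.
Proof. by move=> *; rewrite RintegralZl. Qed.

Lemma le_lint f g : integ f -> integ g -> (forall x, f x <= g x) -> lint f <= lint g.
Proof. by move=> *; apply: le_Rintegral. Qed.

Lemma eq_lint f g : f =1 g -> lint f = lint g.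
Proof. by move=> fg; apply: eq_Rintegral => x _; exact: fg. Qed.

Lemma integD f g : integ f -> integ g -> integ (fun x => f x + g x).
Proof. by move=> fi gi; apply: eq_integrable (integrableD measurableT fi gi). Qed.

Lemma integB f g : integ f -> integ g -> integ (fun x => f x - g x).
Proof. by move=> fi gi; apply: eq_integrable (integrableB measurableT fi gi). Qed.

Lemma integZ (c : R) f : integ f -> integ (fun x => c * f x).
Proof. by move=> fi; apply: eq_integrable (integrableZl measurableT c fi). Qed.

Lemma integ_meas f : integ f -> measurable_fun setT f.
Proof. by move=> fi; apply/measurable_EFinP; exact: measurable_int fi. Qed.

Lemma lint_point (c : R) f : lint (fun x => f x * (x == c)%:R) = 0.
Proof.
rewrite -[RHS](Rintegral_set1 f c) [RHS]Rintegral_mkcond.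
apply: eq_lint => x; rewrite /patch.
have [->|xc] := eqVneq x c; first by rewrite mem_set// mulr1.
by rewrite memNset ?mulr0//; exact/eqP.
Qed.

Lemma integ_tail f (t : R) : integ f -> integ (fun x => f x * tail t x).
Proof.
move=> fi; apply: (integ_dom _ (fun x => `|f x|)).
- by apply: measurable_funM; [exact: integ_meas|exact: measurable_tail].
- exact: integrable_norm fi.
- by move=> x; rewrite normrM (ger0_norm (tail_ge0 _ _)) ler_piMr ?tail_le1.
Qed.

Lemma lint_split f : integ f ->
  lint f = lint (fun x => f x * tail 0 x) + lint (fun x => f (- x) * tail 0 x).
Proof.
move=> fi; have fNi := integ_opp _ fi.
have hN := integ_opp _ (integ_tail _ 0 fNi).
transitivity (lint (fun x => (f x * tail 0 x + f x * tail 0 (- x)) +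
   f x * (x == 0)%:R)).
  apply: eq_lint => x; rewrite /tail oppr_gt0.
  by case: ltrgt0P => _; rewrite ?mulr1 ?mulr0 ?addr0 ?add0r.
have h1 : integ (fun x => f x * tail 0 (- x)).
  by move: hN; under eq_fun do rewrite opprK.
have h2 : integ (fun x => f x * (x == 0)%:R).
  apply: (integ_dom _ (fun x => `|f x|)).
  - apply: measurable_funM; first exact: integ_meas.
    rewrite (_ : (fun x => _) = \1_[set 0]); first exact: measurable_indic.
    apply/funext => x; rewrite indicE.
    have [->|x0] := eqVneq x 0; first by rewrite mem_set.
    by rewrite memNset//; exact/eqP.
  - exact: integrable_norm fi.
  - by move=> x; rewrite normrM normr_nat ler_piMr// lern1 leq_b1.
rewrite lintD//; last by apply: integD => //; exact: integ_tail.
rewrite lintD//; last exact: integ_tail.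
rewrite lint_point addr0; congr (_ + _).
rewrite [RHS]lint_opp; last exact: integ_tail.
by apply: eq_lint => x; rewrite opprK.
Qed.

Lemma lint_even f : integ f -> (forall x, f (- x) = f x) ->
  lint f = 2 * lint (fun x => f x * tail 0 x).
Proof.
move=> fi fe; rewrite lint_split// mulr2n mulrDl !mul1r; congr (_ + _).
by apply: eq_lint => x; rewrite fe.
Qed.

Lemma integ_itv (c u v : R) : u <= v ->
  integ (fun x => c * (tail u x - tail v x)) /\
  lint (fun x => c * (tail u x - tail v x)) = c * (v - u).
Proof.
move=> uv.
have -> : (fun x => c * (tail u x - tail v x)) =
    (fun x => c * \1_(`]u, v]%classic : set R) x).
  apply/funext => x; congr (c * _); rewrite /tail indicE mem_setE in_itv/=.
  by case: (ltP u x) => ux; case: (ltP v x) => vx //=;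
    rewrite ?subrr ?subr0 ?sub0r//; exfalso; lra.
have i1 : integ (\1_(`]u, v]%classic : set R)).
  apply/integ_ge0P => //.
  rewrite integral_indic//= setIT lebesgue_measure_itv/=.
  by case: ifP => // _; rewrite -EFinD ltry.
split; first exact: integZ.
rewrite lintZ//; congr (c * _).
rewrite /Rintegral integral_indic//= setIT lebesgue_measure_itv/= lte_fin.
by case: ltgtP uv => // ->; rewrite subrr.
Qed.

Lemma bounded_integrable d (T : measurableType d) (P : probability T R) (f : T -> R) (M : R) :
  measurable_fun setT f -> (forall x, `|f x| <= M) -> P.-integrable setT (EFin \o f).
Proof.
move=> mf fM; apply: (@le_integrable _ _ _ P setT measurableT _ (EFin \o cst M)).
- exact/measurable_EFinP.
- move=> x _; rewrite lee_fin; apply: le_trans (fM x) _; exact: ler_norm.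
- exact: finite_measure_integrable_cst.
Qed.

End Integrals.

(** * Peak, decay and sixth moment of an isotropic log-concave density *)

Section Isotropic.
Context {R : realType}.
Variable q : R -> R.
Hypotheses (mq : measurable_fun setT q) (q_ge0 : forall x, 0 <= q x)
  (q_sym : symmetric_density q) (q_lc : logconcave q)
  (iq : integ q) (Iq : lint q = 1)
  (i2 : integ (fun x : R => x ^+ 2 * q x)) (I2 : lint (fun x : R => x ^+ 2 * q x) = 1).

Let mpow k : measurable_fun setT (fun x : R => x ^+ k * q x).
Proof. by apply: measurable_funM => //; exact: measurable_funX. Qed.

(* A moment of the half line only: the symmetric tails [|x| > t] carry twice it
   when [k] is even. *)
Definition tail_moment k t := lint (fun x : R => x ^+ k * q x * tail t x).
Local Notation mom := tail_moment.

Let i0 : integ (fun x : R => x ^+ 0 * q x).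
Proof. by under eq_fun do rewrite expr0 mul1r. Qed.

Let i1 : integ (fun x : R => x ^+ 1 * q x).
Proof.
apply: (integ_dom _ (fun x => q x + x ^+ 2 * q x)) => //; first exact: integD.
move=> x; rewrite normrM (ger0_norm (q_ge0 x)) -[X in _ <= X + _]mul1r -mulrDl.
by rewrite ler_wpM2r// ler_norml; apply/andP; split; nra.
Qed.

Lemma mom00 : mom 0 0 = 1 / 2.
Proof.
have := lint_even _ iq q_sym; rewrite Iq /mom => E.
rewrite (eq_lint _ (fun x => q x * tail 0 x)); first by lra.
by move=> x; rewrite expr0 mul1r.
Qed.

Lemma mom20 : mom 2 0 = 1 / 2.
Proof.
have := lint_even _ i2; rewrite I2 /mom => E.
suff : 1 = 2 * lint (fun x : R => x ^+ 2 * q x * tail 0 x) by lra.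
by apply: E => x; rewrite sqrrN q_sym.
Qed.

Lemma q_nincr x y : 0 <= x <= y -> q y <= q x.
Proof. exact: logconcave_nincr. Qed.

Lemma q_le_max x : q x <= q 0.
Proof.
by have [x0|x0] := leP 0 x; [|rewrite -q_sym]; apply: q_nincr; lra.
Qed.

(** By monotonicity the rectangle of base []0, x]] and height [q x] lies under the graph, and the
    half line has mass 1/2. *)
Lemma xq_le x : 0 < x -> x * q x <= 1 / 2.
Proof.
move=> x0; have [ii Ii] := integ_itv (q x) _ _ (ltW x0).
rewrite -mom00 mulrC -[X in _ * X]subr0 -Ii /mom.
apply: le_lint => //; first exact: integ_tail.
move=> y; rewrite expr0 mul1r /tail; have qx := q_ge0 x; have qy := q_ge0 y.
case: (ltP 0 y) => y0; case: (ltP x y) => xy; rewrite ?subrr ?mulr0 ?mulr1 ?subr0//.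
- by rewrite mulr1; apply: q_nincr; rewrite (ltW y0).
- by lra.
Qed.

(* With [h = 1/2], [q (x + h) <= q x * (q h / q 0)] bounds the second moment
   beyond [h] by a multiple of [q h / q 0]; as [q h <= 1], a large [q 0] would
   make the variance smaller than 1. *)
Lemma q0_le : q 0 <= 3.
Proof.
have m1 : mom 1 0 <= 1 / 2.
  suff : mom 1 0 <= 1 / 2 * (mom 0 0 + mom 2 0) by rewrite mom00 mom20; lra.
  rewrite /mom -lintD; try exact: integ_tail.
  rewrite -lintZ; last by apply: integD; exact: integ_tail.
  apply: le_lint; [exact: integ_tail| |].
    by apply: integZ; apply: integD; exact: integ_tail.
  move=> x; rewrite -!mulrDl !mulrA; apply: ler_wpM2r; first exact: tail_ge0.
  by apply: ler_wpM2r => //; rewrite expr0 expr1; have := sqr_ge0 (x - 1); nra.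
pose h : R := 1 / 2; have h0 : 0 < h by rewrite /h; lra.
have ih := integ_tail _ h i2.
have E : mom 2 h = lint (fun x : R => (x + h) ^+ 2 * q (x + h) * tail 0 x).
  rewrite /mom (lint_affine 1 h _ ltr01 ih) mul1r; apply: eq_lint => x.
  by rewrite mul1r /tail ltrDr.
have iE : integ (fun x : R => (x + h) ^+ 2 * q (x + h) * tail 0 x).
  have := integ_affine 1 h _ ltr01 ih.
  by under eq_fun do rewrite mul1r /tail ltrDr.
have mh : q 0 * mom 2 h <= q h * (mom 2 0 + 2 * h * mom 1 0 + h ^+ 2 * mom 0 0).
  have ia := integ_tail _ 0 i0; have ib := integ_tail _ 0 i1.
  have ic := integ_tail _ 0 i2.
  have ib' := integZ (2 * h) _ ib; have ia' := integZ (h ^+ 2) _ ia.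
  have icb := integD _ _ ic ib'.
  rewrite E -lintZ// /mom -(lintZ (2 * h))// -(lintZ (h ^+ 2))// -lintD// -lintD// -lintZ; last first.
    exact: integD.
  apply: le_lint; [exact: integZ|apply: integZ; exact: integD|].
  move=> x; rewrite /tail; case: (ltP 0 x) => x0; last by rewrite !mulr0 !addr0 mulr0.
  rewrite !mulr1 expr0 expr1.
  have T := logconcave_translate q q_ge0 q_lc x h (ltW x0) (ltW h0).
  have := ler_wpM2l (sqr_ge0 (x + h)) T.
  by lra.
have mh2 : mom 2 0 <= h ^+ 2 * mom 0 0 + mom 2 h.
  rewrite /mom -lintZ; last exact: integ_tail.
  rewrite -lintD; [|exact/integZ/integ_tail|exact: integ_tail].
  apply: le_lint; first exact: integ_tail.
    by apply: integD; [exact/integZ/integ_tail|exact: integ_tail].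
  move=> x; rewrite /tail expr0 mul1r; have qx := q_ge0 x.
  case: (ltP 0 x) => x0; case: (ltP h x) => xh; rewrite ?mulr0 ?mulr1 ?addr0 ?add0r//.
  - by rewrite lerDr mulr_ge0// sqr_ge0.
  - by rewrite ler_wpM2r// ler_pXn2r// nnegrE ltW.
  - by rewrite mulr_ge0// sqr_ge0.
(* Here [mh2] gives [mom 2 h >= 3/8], and the bracket in [mh] is at most [1/2 + 1/2 + 1/8]. With
   [q h <= 1] this reads [q 0 * 3/8 <= 9/8]. *)
have := xq_le h h0; move: mh mh2; rewrite mom20 mom00 /h; have := q_ge0 0.
have := q_ge0 (1 / 2).
by nra.
Qed.

(** The mass of []0, 2]] is at most [2 * q 0], and by Chebyshev at most [mom 2 0 / 4 = 1/8] of the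
    half mass 1/2 lies beyond 2. *)
Lemma q0_ge : 3 / 16 <= q 0.
Proof.
have [ii Ii] := integ_itv (q 0) 0 2 (ler0n R 2).
suff : mom 0 0 <= q 0 * (2 - 0) + 1 / 4 * mom 2 0 by rewrite mom00 mom20; lra.
rewrite -Ii /mom -lintZ; last exact: integ_tail.
rewrite -lintD//; last exact/integZ/integ_tail.
apply: le_lint; [exact: integ_tail|apply: integD => //; exact/integZ/integ_tail|].
move=> x; rewrite /tail expr0 mul1r; have qx := q_ge0 x; have qm := q_le_max x.
case: (ltP 0 x) => x0; case: (ltP 2 x) => x2; rewrite ?mulr0 ?mulr1; try lra.
- rewrite subrr mulr0 add0r; have x4 : 4 <= x ^+ 2 by nra.
  by have := ler_wpM2r qx x4; lra.
- by rewrite subr0 mulr1 ler_wpDr// mulr_ge0 ?mulr_ge0 ?sqr_ge0//; lra.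
Qed.

(** Monotone convergence along the truncations at [n]. It allows a self-bounding estimate
    [A <= B + A / 2], void for infinite [A], to be applied to finite quantities first. *)
Lemma ge0_integ_tail_limit (f : R -> R) (N M : R) :
  measurable_fun setT f -> (forall x, 0 <= f x) ->
  (forall n, N <= n%:R -> integ (fun x => f x * (tail 0 x - tail n%:R x)) /\
    lint (fun x => f x * (tail 0 x - tail n%:R x)) <= M) ->
  integ (fun x => f x * tail 0 x) /\ lint (fun x => f x * tail 0 x) <= M.
Proof.
move=> mf f0 fN.
pose g (n : nat) x := (f x * (tail 0 x - tail n%:R x))%:E.
have tn (n : nat) x : 0 <= tail 0 x - tail n%:R x :> R.
  rewrite /tail; case: (ltP 0 x) => x0; case: ltP => xn; rewrite ?subrr ?subr0//.
  by exfalso; have := ler0n R n; lra.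
have g0 n x : (0 <= g n x)%E by rewrite lee_fin mulr_ge0.
have mg n : measurable_fun setT (g n).
  apply/measurable_EFinP; apply: measurable_funM => //.
  by apply: measurable_funB; exact: measurable_tail.
have ndg x : setT x -> {homo g^~ x : n m / (n <= m)%N >-> (n <= m)%E}.
  move=> _ n m nm; rewrite lee_fin ler_wpM2l// lerD2l lerN2 /tail.
  case: (ltP m%:R x) => mx; last exact: ler0n.
  by rewrite (_ : n%:R < x)//; apply: le_lt_trans mx; rewrite ler_nat.
have lg x : limn (g^~ x) = (f x * tail 0 x)%:E.
  apply/cvg_lim => //; apply: cvg_near_cst; near=> n.
  congr EFin; rewrite /tail (_ : (n%:R < x) = false) ?subr0//.
  by apply/negbTE; rewrite -leNgt; near: n; exact: nbhs_infty_ger.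
have ift : (\int[leb]_x (f x * tail 0 x)%:E <= M%:E)%E.
  under eq_integral do rewrite -lg.
  rewrite monotone_convergence//.
  apply: lime_le.
    apply: ereal_nondecreasing_is_cvgn => n m nm; apply: ge0_le_integral => //;
      try exact: mg.
    by move=> x _; exact: ndg.
  near=> n; have nN : N <= n%:R by near: n; exact: nbhs_infty_ger.
  have [ii Ii] := fN n nN.
  by rewrite -[leLHS]fineK ?lee_fin//; exact: integrable_fin_num ii.
have ft0 x : 0 <= f x * tail 0 x by rewrite mulr_ge0// tail_ge0.
have mft : measurable_fun setT (fun x => f x * tail 0 x).
  by apply: measurable_funM => //; exact: measurable_tail.
have ii : integ (fun x => f x * tail 0 x).
  by apply/integ_ge0P => //; apply: le_lt_trans ift _; rewrite ltry.
split=> //; rewrite -lee_fin; apply: le_trans ift.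
by rewrite /Rintegral fineK//; exact: integrable_fin_num ii.
Unshelve. all: by end_near. Qed.

(* Beyond [D] the density loses a factor 256 when its argument doubles, so the
   sixth moment [A] satisfies [A <= (2 D)^6 / 2 + A / 2] on the half line; [A] is
   first truncated at [n] to be known finite. *)
Lemma sixth_moment (D : R) : 256 * 3 <= D ->
  integ (fun x : R => x ^+ 6 * q x) /\
  lint (fun x : R => x ^+ 6 * q x) <= 2 * (2 * D) ^+ 6.
Proof.
move=> hD.
pose f x := x ^+ 6 * q x.
have f0 x : 0 <= f x by rewrite mulr_ge0// exprn_even_ge0.
have mf : measurable_fun setT f := mpow 6.
pose F N x := f x * (tail 0 x - tail N x).
have mF N : measurable_fun setT (F N).
  apply: measurable_funM => //.
  by apply: measurable_funB; exact: measurable_tail.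
have fE x : f (- x) = f x by rewrite /f q_sym exprNn (_ : (-1) ^+ 6 = 1) ?mul1r//; ring.
have FN (N x : R) : 0 <= N -> 0 <= F N x <= N ^+ 6 * q x.
  move=> N0; rewrite /F /tail; have qx := q_ge0 x.
  have B : 0 <= N ^+ 6 * q x by rewrite mulr_ge0// exprn_ge0.
  case: (ltP 0 x) => x0; case: (ltP N x) => xN; rewrite ?subrr ?mulr0 ?lexx ?B//.
    rewrite subr0 mulr1 f0/= /f ler_wpM2r// lerXn2r// nnegrE.
    exact: ltW.
  by exfalso; lra.
have iF N : 0 <= N -> integ (F N).
  move=> N0; apply: (integ_dom _ (fun x => N ^+ 6 * q x)) => //; first exact: integZ.
  by move=> x; have /andP[? ?] := FN N x N0; rewrite ger0_norm.
have qDle : q D <= 1 / (256 * 6).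
  have D0 : 0 < D by lra.
  have := xq_le D D0; have := ler_wpM2r (q_ge0 D) hD; lra.
(* The factor 256 is [2^6 * 2 * 2]: the monomial, the change of variable, and the contraction by
   1/2. It comes from [q x <= q D <= 1 / (256 * 6)] and [q 0 >= 3/16]. *)
have qd x : D <= x -> q (x + x) <= q x / 256.
  move=> xD; have T := logconcave_translate q q_ge0 q_lc x x ltac:(lra) ltac:(lra).
  have q3 := q0_ge; have qx := q_ge0 x; have qxx := q_ge0 (x + x).
  have qxm : q x <= q D by apply: q_nincr; apply/andP; split; lra.
  have : q (x + x) * (3 / 16) <= q x * (1 / (256 * 6)).
    apply: (le_trans (ler_wpM2l qxx q3)); apply: (le_trans T).
    by apply: ler_wpM2l => //; lra.
  by lra.
have [h1 h2] : integ (fun x => f x * tail 0 x) /\ lint (fun x => f x * tail 0 x) <= (2 * D) ^+ 6.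
  apply: (@ge0_integ_tail_limit _ (2 * D)) => // n N2048.
  have N0 : (0 : R) <= n%:R by exact: ler0n.
  split; first exact: iF.
  rewrite -/(F n%:R).
  pose G x := f x * (tail (2 * D) x - tail n%:R x).
  have mG : measurable_fun setT G.
    by apply: measurable_funM => //; apply: measurable_funB; exact: measurable_tail.
  have GF x : 0 <= G x <= F n%:R x.
    rewrite /G /F /tail; have fx := f0 x.
    case: (ltP 0 x) => x0; case: (ltP n%:R x) => xn; case: (ltP (2 * D) x) => x2;
      rewrite ?subrr ?subr0 ?mulr0 ?mulr1 ?lexx ?fx//; exfalso; lra.
  have iG : integ G.
    apply: (integ_dom _ (F n%:R)) => //; first exact: iF.
    by move=> x; have /andP[? ?] := GF x; rewrite ger0_norm.
  have FG : lint (F n%:R) <= (2 * D) ^+ 6 * mom 0 0 + lint G.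
    rewrite /mom -lintZ; last exact: integ_tail.
    rewrite -lintD//; last exact/integZ/integ_tail.
    apply: le_lint; [exact: iF|by apply: integD => //; exact/integZ/integ_tail|].
    move=> x; rewrite /F /G expr0 mul1r mulrA; have qx := q_ge0 x; have fx := f0 x.
    have B : 0 <= (2 * D) ^+ 6 * q x by rewrite mulr_ge0// exprn_ge0//; lra.
    have fB : 0 < x -> x <= 2 * D -> f x <= (2 * D) ^+ 6 * q x.
      by move=> x0 xD; rewrite /f ler_wpM2r// lerXn2r// nnegrE; lra.
    rewrite /tail; move: fB; case: (ltP 0 x) => x0; case: (ltP (2 * D) x) => x2;
      case: (ltP n%:R x) => xn /=; rewrite ?mulr1n ?mulr0n => fB; try lra.
  have iG2 := integ_affine 2 0 _ (ltr0n R 2) iG.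
  have EG := lint_affine 2 0 _ (ltr0n R 2) iG.
  have GF2 : lint (fun x => G (2 * x + 0)) <= 1 / 4 * lint (F n%:R).
    rewrite -lintZ; last exact: iF.
    apply: le_lint => //; first exact/integZ/iF.
    move=> x; rewrite addr0 {1}/G {1 2}/tail ltr_pM2l//.
    have /andP[Fx _] := FN n%:R x N0.
    have R0 : 0 <= 1 / 4 * F n%:R x by rewrite mulr_ge0// divr_ge0.
    case: (ltP D x) => xD; case: (ltP n%:R (2 * x)) => xn;
      rewrite ?subrr ?mulr0 ?subr0 ?mulr1//; last by exfalso; lra.
    have D0 : 0 < D by apply: lt_le_trans hD; apply: mulr_gt0; rewrite ltr0n.
    have x0 : 0 < x by exact: lt_trans xD.
    have xn' : (n%:R < x) = false.
      by apply/negbTE; rewrite -leNgt; apply: le_trans xn; apply: ler_peMl;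
        rewrite ?ler1n ?ltW.
    rewrite /F /tail x0 xn' subr0 mulr1.
    have -> : f (2 * x) = 2 ^+ 6 * (x ^+ 6 * q (x + x)).
      by rewrite /f exprMn -mulrA (_ : x + x = 2 * x)//; ring.
    have x6 : 0 <= x ^+ 6 by exact: exprn_even_ge0.
    have T := ler_wpM2l x6 (qd x (ltW xD)).
    apply: (le_trans (ler_wpM2l _ T)); first by rewrite exprn_ge0.
    by rewrite /f le_eqVlt; apply/orP; left; apply/eqP; field.
  by move: FG; rewrite mom00 EG; lra.
have h1N := integ_opp _ h1.
have fT x : f x = f x * tail 0 x + f (- x) * tail 0 (- x).
  rewrite fE -mulrDr /tail oppr_gt0.
  case: ltrgt0P => [_|_|->]; rewrite ?addr0 ?add0r ?mulr1//.
  by rewrite /f expr0n !mul0r.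
split.
  rewrite -/f (_ : f = fun x => f x * tail 0 x + f (- x) * tail 0 (- x)).
    exact: integD.
  exact/funext.
rewrite (eq_lint _ _ fT) lintD// -(lint_opp _ h1).
by lra.
Qed.

End Isotropic.

(** * Kurtosis of the tails *)

Section Crossing.
Context {R : realType}.
Implicit Types D h : R -> R.

Lemma lint_ge0_eq0 h g : (forall x, 0 <= h x) -> integ h -> lint h = 0 ->
  measurable_fun setT (g : R -> R) -> lint (fun x => g x * h x) = 0.
Proof.
move=> h0 ih Ih mg; have mh := integ_meas _ ih.
have mhE : measurable_fun setT (EFin \o h) by exact/measurable_EFinP.
have h_ae : ae_eq leb setT (EFin \o h) (cst 0%E).
  apply: (iffLR (ae_eq_integral_abs leb measurableT mhE)).
  under eq_integral do rewrite gee0_abs ?lee_fin//.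
  by rewrite -[LHS]fineK ?(integrable_fin_num _ ih)// -[fine _]/(lint h) Ih.
rewrite /Rintegral (ae_eq_integral (cst 0%E)) ?integral0//.
- by apply/measurable_EFinP; exact: measurable_funM.
- apply: filterS h_ae => x /(_ Logic.I) /= [->] _; by rewrite mulr0.
Qed.

(* [D] has sign pattern -, +, - with changes at [s1] and [s2], so that
   [(x^2 - s1^2) (x^2 - s2^2) D x] is nonpositive; its integral is that of
   [x^4 D x].  When [s2] is infinite, [(x^2 - s1^2) D x >= 0] has zero integral,
   hence vanishes almost everywhere. *)
Lemma two_crossings D (s1 : R) : 0 <= s1 ->
  (forall x, x <= 0 -> D x = 0) -> (forall x, x <= s1 -> D x <= 0) ->
  (forall x y, s1 < x -> x < y -> 0 < D y -> 0 <= D x) ->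
  integ D -> integ (fun x => x ^+ 2 * D x) -> integ (fun x => x ^+ 4 * D x) ->
  lint D = 0 -> lint (fun x => x ^+ 2 * D x) = 0 -> lint (fun x => x ^+ 4 * D x) <= 0.
Proof.
move=> s10 D0 Ds1 Dcr i0 i2 i4 I0 I2.
(* By hypothesis [D] is nonnegative between [s1] and any point of [W], so the second sign change
   sits at [sup W], or at infinity when [W] is unbounded. *)
pose W := [set x | s1 < x /\ 0 < D x].
have [Wb|Wub] := pselect (has_ubound W); last first.
  pose h x := (x ^+ 2 - s1 ^+ 2) * D x.
  have hE : h = fun x => x ^+ 2 * D x - s1 ^+ 2 * D x.
    by apply/funext => x; rewrite /h mulrBl.
  have h0 x : 0 <= h x.
    rewrite /h; have [xs1|xs1] := leP x s1.
      have [x0|x0] := leP x 0; first by rewrite D0// mulr0.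
      have := Ds1 x xs1; have : x ^+ 2 <= s1 ^+ 2 by rewrite lerXn2r// nnegrE ltW.
      by move=> ? ?; nra.
    rewrite mulr_ge0//.
      by rewrite subr_ge0 lerXn2r// ?nnegrE ?(ltW xs1)//; exact: le_trans (ltW xs1).
    apply: contrapT => Dx; apply: Wub; exists x => y [s1y Dy].
    by rewrite leNgt; apply/negP => xy; apply: Dx; exact: Dcr xy Dy.
  have ih : integ h by rewrite hE; apply: integB => //; exact: integZ.
  have Ih : lint h = 0 by rewrite hE lintB ?lintZ ?I0 ?I2 ?mulr0 ?subrr//; exact: integZ.
  have := lint_ge0_eq0 h (fun x => x ^+ 2) h0 ih Ih (@exprn_measurable R setT 2).
  rewrite (eq_lint _ (fun x => x ^+ 4 * D x - s1 ^+ 2 * (x ^+ 2 * D x))).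
    have ii : integ (fun x => s1 ^+ 2 * (x ^+ 2 * D x)) by exact: integZ.
    by rewrite lintB// lintZ// I2 mulr0 subr0 => ->.
  by move=> x; rewrite /h; ring.
(* If [W] is empty then [D <= 0] everywhere, and the two crossings are merged at [s1]. *)
pose s2 := if pselect (W !=set0) is left _ then sup W else s1.
have s12 : s1 <= s2.
  rewrite /s2; case: pselect => // -[w Ww]; apply: (@le_trans _ _ w).
    by case: Ww => /ltW.
  by apply: ub_le_sup.
have Dpos x : s1 < x -> x < s2 -> 0 <= D x.
  rewrite /s2; case: pselect => [W0|_] s1x xs2; last by exfalso; lra.
  have [y [s1y Dy] xy] := sup_gt W0 xs2.
  exact: Dcr xy Dy.
have Dneg x : s2 < x -> D x <= 0.
  move=> s2x; rewrite leNgt; apply/negP => Dx.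
  have Wx : W x by split => //; exact: le_lt_trans s2x.
  move: s2x; rewrite /s2; case: pselect => [W0|[]]; last by exists x.
  by rewrite ltNge ub_le_sup.
pose k x := (x ^+ 4 * D x - (s1 ^+ 2 + s2 ^+ 2) * (x ^+ 2 * D x)) + (s1 ^+ 2 * s2 ^+ 2) * D x.
have ik : integ k.
  by apply: integD; [apply: integB => //; exact: integZ|exact: integZ].
have kE x : k x = D x * ((x ^+ 2 - s1 ^+ 2) * (x ^+ 2 - s2 ^+ 2)) by rewrite /k; ring.
have s20 : 0 <= s2 by exact: le_trans s12.
have k0 x : k x <= 0.
  rewrite kE; have [x0|x0] := leP x 0; first by rewrite D0// mul0r.
  have sq (u v : R) : 0 <= u -> u <= v -> u ^+ 2 <= v ^+ 2.
    by move=> u0 uv; rewrite lerXn2r// nnegrE//; lra.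
  have [xs1|xs1] := leP x s1.
    apply: mulr_le0_ge0; first exact: Ds1.
    by apply: mulr_le0; rewrite subr_le0; apply: sq; lra.
  have [xs2|xs2] := ltP x s2.
    apply: mulr_ge0_le0; first exact: Dpos.
    by apply: mulr_ge0_le0; rewrite ?subr_ge0 ?subr_le0; apply: sq; lra.
  have [->|xs2'] := eqVneq x s2; first by rewrite subrr !mulr0.
  have {xs2}xs2 : s2 < x by rewrite lt_neqAle eq_sym xs2'.
  apply: mulr_le0_ge0; first exact: Dneg.
  by apply: mulr_ge0; rewrite subr_ge0; apply: sq; lra.
have : lint k <= 0.
  have -> : 0 = lint (fun _ : R => 0) :> R by rewrite /Rintegral integral0.
  apply: le_lint => //; exact: integrable0.
have j2 : integ (fun x => (s1 ^+ 2 + s2 ^+ 2) * (x ^+ 2 * D x)) by exact: integZ.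
have j0 : integ (fun x => (s1 ^+ 2 * s2 ^+ 2) * D x) by exact: integZ.
by rewrite /k lintD//; [rewrite lintB// !lintZ// I0 I2 !mulr0 subr0 addr0|exact: integB].
Qed.

End Crossing.

Section TailMoments.
Context {R : realType}.
Variable q : R -> R.
Hypotheses (mq : measurable_fun setT q) (q_ge0 : forall x, 0 <= q x)
  (q_sym : symmetric_density q) (q_lc : logconcave q)
  (ik : forall k, (k <= 4)%N -> integ (fun x : R => x ^+ k * q x)).
Local Notation mom := (tail_moment q).
Local Notation ratio t := (mom 2 t / mom 0 t).

Let it k t : (k <= 4)%N -> integ (fun x : R => x ^+ k * q x * tail t x).
Proof. by move=> k4; apply: integ_tail; exact: ik. Qed.

Lemma mom_band k (t0 t : R) : (k <= 4)%N ->
  integ (fun x => x ^+ k * q x * (tail t0 x - tail t x)) /\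
  mom k t0 - mom k t = lint (fun x => x ^+ k * q x * (tail t0 x - tail t x)).
Proof.
move=> k4; rewrite /mom -lintB; [|exact: it|exact: it].
split; last by apply: eq_lint => x; rewrite mulrBr.
by under eq_fun do rewrite mulrBr; apply: integB; exact: it.
Qed.

Lemma tailB (t0 t x : R) : t0 <= t ->
  tail t0 x - tail t x = ((t0 < x) && (x <= t))%:R.
Proof.
by move=> t0t; rewrite /tail; case: (ltP t0 x) => h1; case: (ltP t x) => h2 /=;
  rewrite ?subrr ?subr0//; exfalso; lra.
Qed.

Lemma mom_ge0 k (t : R) : 0 <= t -> 0 <= mom k t.
Proof.
move=> t0; apply: Rintegral_ge0 => x _; rewrite /tail.
have [tx|tx] := ltP t x; last by rewrite mulr0.
by rewrite !mulr_ge0// exprn_ge0//; lra.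
Qed.

Lemma mom_nincr k (t0 t : R) : (k <= 4)%N -> 0 <= t0 <= t -> mom k t <= mom k t0.
Proof.
move=> k4 /andP[t00 t0t]; have [_ E] := mom_band k t0 t k4.
rewrite -subr_ge0 E; apply: Rintegral_ge0 => x _; rewrite tailB//.
have [tx|tx] := ltP t0 x; last by rewrite mulr0.
by rewrite !mulr_ge0// exprn_ge0//; lra.
Qed.

Lemma mom2_ge (t : R) : 0 <= t -> t ^+ 2 * mom 0 t <= mom 2 t.
Proof.
move=> t0; rewrite /mom -lintZ; last exact: it.
apply: le_lint; [exact/integZ/it|exact: it|] => x; rewrite mulrA /tail.
case: ltP => xt; last by rewrite !mulr0.
rewrite !mulr1 expr0 mul1r ler_wpM2r// lerXn2r// ?nnegrE; lra.
Qed.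

Lemma mom2_band_le (t0 t : R) : 0 <= t0 <= t ->
  mom 2 t0 - mom 2 t <= t ^+ 2 * (mom 0 t0 - mom 0 t).
Proof.
move=> /andP[t00 t0t]; have [i2 ->] := mom_band 2 t0 t isT.
have [i0 ->] := mom_band 0 t0 t isT.
rewrite -lintZ//; apply: le_lint => //; first exact: integZ.
move=> x; rewrite tailB// mulrA expr0 mul1r.
have [xt|xt] := ltP t0 x; last by rewrite !mulr0.
have [xt'|xt'] := leP x t; last by rewrite !mulr0.
rewrite !mulr1 ler_wpM2r// lerXn2r// ?nnegrE; lra.
Qed.

(** What is removed between [t0] and [t] has [x^2 <= t^2], what remains has [x^2 >= t^2], so the
    conditional second moment can only grow. This makes the scaling factor [s] of the kurtosis
    comparison at least 1. *)
Lemma ratio_mono (t0 t : R) : 0 <= t0 <= t ->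
  mom 2 t0 * mom 0 t <= mom 2 t * mom 0 t0.
Proof.
move=> t0t; have h1 := mom2_band_le _ _ t0t; have h3 := mom_nincr 0 _ _ isT t0t.
have /andP[t00 tt0] := t0t.
have tt : 0 <= t by exact: le_trans tt0.
have h2 := mom2_ge _ tt; have h4 := mom_ge0 0 t tt.
have a := ler_wpM2r h4 h1.
have h3' : 0 <= mom 0 t0 - mom 0 t by rewrite subr_ge0.
have b := ler_wpM2r h3' h2.
lra.
Qed.

Lemma mom_scale k (s t : R) : 0 < s -> (k <= 4)%N ->
  integ (fun x => x ^+ k * q (s * x) * tail t (s * x)) /\
  mom k t = s ^+ k.+1 * lint (fun x => x ^+ k * q (s * x) * tail t (s * x)).
Proof.
move=> s0 k4.
have E x : (s * x + 0) ^+ k * q (s * x + 0) * tail t (s * x + 0) =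
    s ^+ k * (x ^+ k * q (s * x) * tail t (s * x)).
  by rewrite addr0 exprMn !mulrA.
have ii : integ (fun x => x ^+ k * q (s * x) * tail t (s * x)).
  have := integ_affine s 0 _ s0 (it k t k4); under eq_fun do rewrite E.
  move=> /(integZ (s ^+ k)^-1); under eq_fun do rewrite mulKf ?expf_neq0 ?gt_eqF//.
  by [].
split=> //; rewrite /mom (lint_affine s 0 _ s0 (it k t k4)) exprS -mulrA; congr (_ * _).
by rewrite -lintZ//; exact: eq_lint.
Qed.

(* [D] compares the two tails, normalized to equal masses and second moments:
   [s ^+ 2] is the ratio of the conditional second moments. *)
Lemma tail_kurtosis_nincr (t0 t : R) : 0 < t0 <= t -> 0 < mom 0 t ->
  mom 4 t * mom 0 t * mom 2 t0 ^+ 2 <= mom 4 t0 * mom 0 t0 * mom 2 t ^+ 2.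
Proof.
move=> /andP[t00 t0t] m0t.
have tp : 0 < t by exact: lt_le_trans t0t.
have t0t' : 0 <= t0 <= t by rewrite ltW.
have m0t0 : 0 < mom 0 t0 by exact: lt_le_trans (mom_nincr 0 _ _ isT t0t').
have m2 (u : R) : 0 < u -> 0 < mom 0 u -> 0 < mom 2 u.
  move=> u0 mu; apply: lt_le_trans (mom2_ge _ (ltW u0)).
  by rewrite mulr_gt0// exprn_gt0.
have m2t := m2 t tp m0t; have m2t0 := m2 t0 t00 m0t0.
pose s := Num.sqrt ((mom 2 t * mom 0 t0) / (mom 2 t0 * mom 0 t)).
have d0 : 0 < mom 2 t0 * mom 0 t by exact: mulr_gt0.
have s1 : 1 <= s.
  by rewrite -sqrtr1 ler_wsqrtr// ler_pdivlMr// mul1r ratio_mono.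
have s0 : 0 < s by exact: lt_le_trans s1.
have s2 : s ^+ 2 = (mom 2 t * mom 0 t0) / (mom 2 t0 * mom 0 t).
  by rewrite sqr_sqrtr// divr_ge0// mulr_ge0// ltW.
(* The substitution [x -> s * x] divides the mass by [s]; these constants turn both terms of [D]
   into probability densities. *)
pose c := s / mom 0 t; pose c0 := (mom 0 t0)^-1.
have c_gt0 : 0 < c by rewrite divr_gt0.
have c0_gt0 : 0 < c0 by rewrite invr_gt0.
pose D x := c * (q (s * x) * tail t (s * x)) - c0 * (q x * tail t0 x).
have DE k : (fun x : R => x ^+ k * D x) = fun x =>
    c * (x ^+ k * q (s * x) * tail t (s * x)) - c0 * (x ^+ k * q x * tail t0 x).
  by apply/funext => x; rewrite /D; ring.
have iD k : (k <= 4)%N -> integ (fun x : R => x ^+ k * D x).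
  move=> k4; rewrite DE; apply: integB; apply: integZ; last exact: it.
  by have [] := mom_scale k s t s0 k4.
have ID' k : (k <= 4)%N -> lint (fun x : R => x ^+ k * D x) =
    c * (mom k t / s ^+ k.+1) - c0 * mom k t0.
  move=> k4; have [ii ->] := mom_scale k s t s0 k4.
  rewrite DE lintB; [|exact: integZ|exact/integZ/it].
  rewrite !lintZ//; last exact: it.
  by rewrite (mulrAC (s ^+ k.+1)) mulfV ?mul1r// expf_neq0// gt_eqF.
have sn : s != 0 by rewrite gt_eqF.
have [n0 n0' n2 n2'] : [/\ mom 0 t != 0, mom 0 t0 != 0, mom 2 t != 0 & mom 2 t0 != 0].
  by split; rewrite gt_eqF.
have E0 : lint (fun x : R => x ^+ 0 * D x) = 0.
  by rewrite ID'// /c /c0 expr1; field; rewrite n0 n0' sn.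
have E2 : lint (fun x : R => x ^+ 2 * D x) = 0.
  rewrite ID'// (_ : c * _ = mom 2 t / mom 0 t / s ^+ 2); last first.
    by rewrite /c; field; rewrite sn n0.
  by rewrite s2 /c0; field; rewrite n0 n0' n2 n2'.
have : lint (fun x : R => x ^+ 4 * D x) <= 0.
  (* The contracted tail starts at [t / s]. If this is at or beyond [t0], then [D <= 0] up to there;
     otherwise no negative stretch comes first, and the first crossing is placed at 0. *)
  pose s1' := if t0 <= t / s then t / s else 0.
  have ts0 : 0 < t / s by exact: divr_gt0.
  have tail_s x : tail t (s * x) = tail (t / s) x by rewrite /tail ltr_pdivrMr// mulrC.
  have tail0 (u x : R) : x <= u -> tail u x = 0 by rewrite /tail leNgt => /negbTE ->.
  have tail1 (u x : R) : u < x -> tail u x = 1 by rewrite /tail => ->.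
  apply: (two_crossings D s1').
  - by rewrite /s1'; case: ifP => // _; exact: ltW.
  - by move=> x x0; rewrite /D tail_s !tail0 ?mulr0 ?subrr//; lra.
  - move=> x xs1; rewrite /D tail_s tail0; last first.
      by apply: (le_trans xs1); rewrite /s1'; case: ifP => // _; exact: ltW.
    by rewrite !mulr0 sub0r oppr_le0 mulr_ge0 ?(ltW c0_gt0)// mulr_ge0// tail_ge0.
  - move=> x y s1x xy; rewrite /D !tail_s => Dy.
    have [xt0|xt0] := leP x t0.
      rewrite (tail0 t0)// !mulr0 subr0 mulr_ge0 ?(ltW c_gt0)// mulr_ge0// tail_ge0.
    have tsx : t / s < x.
      by move: s1x; rewrite /s1'; case: ifP => // /negbT; rewrite -ltNge => h _;
        exact: lt_trans xt0.
    have t0y := lt_trans xt0 xy; have tsy := lt_trans tsx xy.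
    move: Dy; rewrite !tail1// !mulr1 subr_gt0 subr_ge0 => Dy.
    have x0 : 0 <= x by apply: ltW; exact: lt_trans xt0.
    have qsy : 0 < q (s * y).
      rewrite lt_neqAle q_ge0 andbT eq_sym; apply: contraTneq Dy => ->.
      by rewrite mulr0 -leNgt mulr_ge0// ltW.
    have qy : 0 < q y.
      apply: (lt_le_trans qsy); apply: logconcave_nincr => //.
      apply/andP; split; first by exact: le_trans (ltW xy).
      by rewrite ler_peMl//; exact: le_trans (ltW xy).
    have T : q (s * y) * q x <= q (s * x) * q y.
      by apply: logconcave_scale => //; rewrite x0 ltW.
    rewrite -(ler_pM2r qy) -mulrA (mulrC (q x)) mulrA.
    apply: (@le_trans _ _ (c * (q (s * y) * q x))).
      by rewrite mulrA ler_wpM2r// ltW.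
    by rewrite -(mulrA c (q (s * x))) ler_wpM2l// ltW.
  - by have := iD 0 isT; under eq_fun do rewrite expr0 mul1r.
  - exact: iD.
  - exact: iD.
  - by rewrite -[RHS]E0; apply: eq_lint => x; rewrite expr0 mul1r.
  - exact: E2.
rewrite ID'// subr_le0 (_ : c * _ = mom 4 t / mom 0 t / (s ^+ 2) ^+ 2); last first.
  by rewrite /c; field; rewrite sn n0.
rewrite s2 /c0 => T.
have P : 0 < mom 2 t ^+ 2 * mom 0 t0 ^+ 2 by rewrite mulr_gt0 ?exprn_gt0.
move: T; rewrite -(ler_pM2r P).
rewrite (_ : mom 4 t / _ / _ * _ = mom 4 t * mom 0 t * mom 2 t0 ^+ 2); last first.
  by field; rewrite n0 n0' n2 n2'.
by rewrite (_ : _^-1 * _ * _ = mom 4 t0 * mom 0 t0 * mom 2 t ^+ 2)//; field.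
Qed.

End TailMoments.

(** * Quantitative drop of the kurtosis for a symmetric band *)

Section KurtosisGap.
Context {R : realType}.
Variable q : R -> R.
Hypotheses (mq : measurable_fun setT q) (q_ge0 : forall x, 0 <= q x)
  (q_sym : symmetric_density q) (q_lc : logconcave q)
  (iq : integ q) (Iq : lint q = 1)
  (i2 : integ (fun x : R => x ^+ 2 * q x)) (I2 : lint (fun x : R => x ^+ 2 * q x) = 1)
  (ik : forall k, (k <= 4)%N -> integ (fun x : R => x ^+ k * q x)).
Local Notation mom := (tail_moment q).

Let m00 : mom 0 0 = 1 / 2 := mom00 q q_sym iq Iq.
Let m20 : mom 2 0 = 1 / 2 := mom20 q q_sym i2 I2.

Lemma mom0_band (t0 t : R) : 0 <= t0 <= t ->
  q t * (t - t0) <= mom 0 t0 - mom 0 t <= q t0 * (t - t0).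
Proof.
move=> /andP[t00 t0t]; have [i0 ->] := mom_band q ik 0 t0 t isT.
have [ja Ja] := integ_itv (q t) _ _ t0t; have [jb Jb] := integ_itv (q t0) _ _ t0t.
rewrite -Ja -Jb; apply/andP; split; apply: le_lint => // x;
  rewrite expr0 mul1r tailB//; case: (ltP t0 x) => h1; case: (leP x t) => h2;
  rewrite ?mulr0// !mulr1; apply: logconcave_nincr => //; lra.
Qed.

(** The integrand [x * q x] is at most 1/2. This bounds the mean left by an asymmetric band with an
    absolute constant. *)
Lemma mom1_band (t0 t : R) : 0 <= t0 <= t -> mom 1 t0 - mom 1 t <= 1 / 2 * (t - t0).
Proof.
move=> /andP[t00 t0t]; have [i1 ->] := mom_band q ik 1 t0 t isT.
have [ja Ja] := integ_itv (1 / 2 : R) _ _ t0t.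
rewrite -Ja; apply: le_lint => // x.
rewrite expr1 tailB//; case: (ltP t0 x) => h1; case: (leP x t) => h2;
  rewrite ?mulr0// !mulr1; apply: xq_le => //; lra.
Qed.

(** Both half-line moments start from 1/2, and for [t <= 1] the removed part loses at least as much
    mass as second moment. Consequently the law with its band removed has second moment at least
    1. *)
Lemma mom2_ge_mom0 (t : R) : 0 <= t -> mom 0 t <= mom 2 t.
Proof.
move=> t0; have m0 := mom_ge0 q q_ge0 0 t t0.
have [t1|t1] := leP 1 t.
  apply: le_trans (mom2_ge q q_ge0 ik t t0).
  by rewrite ler_peMl// exprn_ege1.
have t0' : (0 : R) <= 0 <= t by rewrite lexx.
have := mom2_band_le q q_ge0 ik 0 t t0'; have := mom_nincr q q_ge0 ik 0 0 t isT t0'.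
rewrite m00 m20 => h1 h2.
have t2 : t ^+ 2 <= 1 by rewrite expr_le1// ltW.
have h1' : 0 <= 1 / 2 - mom 0 t by rewrite subr_ge0.
have := ler_wpM2r h1' t2; lra.
Qed.

Lemma mom4_ge : 1 / 2 <= mom 4 0.
Proof.
have i_t k : (k <= 4)%N -> integ (fun x : R => x ^+ k * q x * tail 0 x).
  by move=> k4; apply: integ_tail; exact: ik.
suff : 2 * mom 2 0 - mom 0 0 <= mom 4 0 by rewrite m00 m20; lra.
have j : integ (fun x : R => 2 * (x ^+ 2 * q x * tail 0 x)) by exact/integZ/i_t.
rewrite /mom -lintZ; last exact: i_t.
rewrite -lintB//; last exact: (i_t 0).
apply: le_lint; [by apply: integB => //; exact: (i_t 0)|exact: i_t|] => x.
have h : 2 * x ^+ 2 - 1 <= x ^+ 4.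
  by have := sqr_ge0 (x ^+ 2 - 1); rewrite sqrrB1 -exprM; lra.
have := ler_wpM2r (mulr_ge0 (q_ge0 x) (tail_ge0 0 x)) h.
by rewrite expr0; lra.
Qed.

(** Beyond 2 lies mass at most [mom 2 0 / 4 = 1/8], and by monotonicity []1/2, 2]] carries at most
    three times the mass of []0, 1/2]]; the latter is therefore at least 3/32. *)
Lemma mom0_half : 3 / 16 <= 1 - 2 * mom 0 (1 / 2).
Proof.
have /andP[_ h1] := mom0_band (1 / 2) 2 ltac:(lra).
have /andP[h2 _] := mom0_band 0 (1 / 2) ltac:(lra).
have h3 := mom2_ge q q_ge0 ik 2 ltac:(lra).
have h4 := mom_nincr q q_ge0 ik 2 0 2 isT ltac:(lra).
move: h1 h2 h3 h4; rewrite m00 m20 (_ : 2 ^+ 2 = 4 :> R); last by ring.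
lra.
Qed.

(** The fourth moment can only fall, while the band takes away second moment at most 1/4 of its
    mass, so that [mom 2 t >= 3/8 + a / 4] with [a = mom 0 t]. Here [2 * mom 4 0] is the kurtosis of
    [q], and [1/2 + a] is 1 minus half the mass of the symmetric band. *)
Lemma kurtosis_gap_small (t : R) : 0 <= t <= 1 / 2 ->
  mom 4 t * mom 0 t <= 2 * mom 4 0 * (1 / 2 + mom 0 t) * mom 2 t ^+ 2.
Proof.
move=> /andP[t0 t2]; have t0' : (0 : R) <= 0 <= t by rewrite lexx.
have h4 := mom_nincr q q_ge0 ik 4 0 t isT t0'.
have h0 := mom_ge0 q q_ge0 0 t t0.
have h0' := mom_nincr q q_ge0 ik 0 0 t isT t0'.
have hb := mom2_band_le q q_ge0 ik 0 t t0'.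
have m4 := mom4_ge.
move: h0' hb; rewrite m00 m20; set a := mom 0 t in h0 * => h0' hb.
have t4 : t ^+ 2 <= 1 / 4 by nra.
have h2 : 3 / 8 + 1 / 4 * a <= mom 2 t.
  have h1' : 0 <= 1 / 2 - a by lra.
  by have := ler_wpM2r h1' t4; lra.
have h22 : (3 / 8 + 1 / 4 * a) ^+ 2 <= mom 2 t ^+ 2.
  by rewrite lerXn2r// nnegrE; lra.
apply: (@le_trans _ _ (mom 4 0 * a)); first by rewrite ler_wpM2r.
have K : a <= 2 * (1 / 2 + a) * mom 2 t ^+ 2.
  have : 2 * (1 / 2 + a) * (3 / 8 + 1 / 4 * a) ^+ 2 <= 2 * (1 / 2 + a) * mom 2 t ^+ 2.
    by apply: ler_wpM2l => //; lra.
  apply: le_trans; rewrite -subr_ge0.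
  (* The double root at [a = 1/2], where nothing is removed, shows that half the band mass is
     exactly the first-order drop that this argument yields. *)
  rewrite (_ : _ - _ = (1 - 2 * a) ^+ 2 * (9 + 2 * a) / 64); last by field.
  by rewrite divr_ge0// mulr_ge0 ?sqr_ge0//; lra.
have m40 : 0 <= mom 4 0 by lra.
have := ler_wpM2l m40 K; lra.
Qed.

(* [1 - 2 * mom 0 t] is the mass of the removed symmetric band [-t, t]. *)
Lemma kurtosis_gap (t : R) : 0 < t -> 0 < mom 0 t ->
  mom 4 t * mom 0 t <=
    2 * mom 4 0 * (1 - 3 / 32 * (1 - 2 * mom 0 t)) * mom 2 t ^+ 2.
Proof.
move=> t0 m0; have m4 := mom4_ge.
have t0' : (0 : R) <= 0 <= t by rewrite lexx ltW.
have h0' := mom_nincr q q_ge0 ik 0 0 t isT t0'; rewrite m00 in h0'.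
have [t2|t2] := leP t (1 / 2).
  apply: le_trans (kurtosis_gap_small t _) _; first by lra.
  rewrite ler_wpM2r ?sqr_ge0// ler_wpM2l//; lra.
have u0 : (0 : R) < 1 / 2 by lra.
have ut : (0 : R) < 1 / 2 <= t by rewrite u0 ltW.
(* Past 1/2 the bound at 1/2 is inherited. Its factor is at most [1 - 3/32] by [mom0_half], and the
   mass of the larger band is at most 1, so 3/32 serves as a slope in both regimes. *)
have T := tail_kurtosis_nincr q q_ge0 q_sym q_lc ik (1 / 2) t ut m0.
have S := kurtosis_gap_small (1 / 2) ltac:(lra).
have p2 := mom0_half.
have m0u : 0 < mom 0 (1 / 2).
  by apply: lt_le_trans m0 _; apply: mom_nincr => //; lra.
have m2u : 0 < mom 2 (1 / 2) by exact: lt_le_trans (mom2_ge_mom0 _ (ltW u0)).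
have m2u2 : 0 < mom 2 (1 / 2) ^+ 2 by rewrite exprn_gt0.
rewrite -(ler_pM2r m2u2); apply: (le_trans T).
apply: (le_trans (ler_wpM2r (sqr_ge0 _) S)).
rewrite [leLHS]mulrAC; apply: ler_wpM2r; first exact: sqr_ge0.
apply: ler_wpM2r; first exact: sqr_ge0.
by apply: ler_wpM2l; lra.
Qed.

End KurtosisGap.

(** * Removal of an almost symmetric band *)

Section BandArithmetic.
Context {R : realFieldType}.

Lemma eps_pow4_le (e : R) : 0 < e <= 1 / 3 -> e ^+ 4 <= e / 27.
Proof.
move=> /andP[e0 e3].
have e2 : 0 <= e ^+ 2 <= 1 / 9 by apply/andP; split; nra.
have /andP[h1 h2] := e2.
have : e ^+ 3 <= 1 / 27 by rewrite exprS; nra.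
by rewrite (exprS e 3) => h3; have := ler_wpM2l (ltW e0) h3; lra.
Qed.

(* [y], [x], [z] are the moments of order 0, 2, 4 of the two tails.  The mixture
   exceeds the common kurtosis bound only through the square
   [(x2 * y1 - x1 * y2) ^+ 2], which is of order [e ^+ 8]. *)
Lemma mixed_kurtosis (e k g y1 y2 x1 x2 z1 z2 : R) :
  0 < e <= 1 / 3 -> 0 <= k -> 0 <= g <= 1 -> e <= y2 <= y1 ->
  y1 - y2 <= 3 * e ^+ 5 -> 0 <= x2 <= x1 -> x1 * y2 <= x2 * y1 ->
  z1 * y1 <= k * (1 - g) * x1 ^+ 2 -> z2 * y2 <= k * (1 - g) * x2 ^+ 2 ->
  (z1 + z2) * (y1 + y2) <= k * (1 - g) * (1 + e / 400) * (x1 + x2) ^+ 2.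
Proof.
move=> /andP[e0 e3] k0 /andP[g0 g1] /andP[ey2 y21] y12 /andP[x20 x21] xy zy1 zy2.
have y20 : 0 < y2 by exact: lt_le_trans ey2.
have y10 : 0 < y1 by exact: lt_le_trans y21.
set c := k * (1 - g) in zy1 zy2 *.
have c0 : 0 <= c by rewrite mulr_ge0// subr_ge0.
have z1' : z1 <= c * x1 ^+ 2 / y1 by rewrite ler_pdivlMr.
have z2' : z2 <= c * x2 ^+ 2 / y2 by rewrite ler_pdivlMr.
apply: (@le_trans _ _ ((c * x1 ^+ 2 / y1 + c * x2 ^+ 2 / y2) * (y1 + y2))).
  by rewrite ler_wpM2r ?lerD// addr_ge0// ltW.
rewrite (_ : _ * _ = c * ((x1 + x2) ^+ 2 + (x2 * y1 - x1 * y2) ^+ 2 / (y1 * y2))); last first.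
  by field; rewrite !gt_eqF.
rewrite -[leRHS]mulrA; apply: ler_wpM2l => //.
rewrite mulrDl mul1r lerD2l.
have e4 : e ^+ 4 <= e / 27 by apply: eps_pow4_le; rewrite e0.
(* The lower bound [e <= y2] turns the absolute difference [3 * e ^+ 5] into a relative one,
   [3 * e ^+ 4 <= e / 9]. *)
have dy : y1 - y2 <= e / 9 * y2.
  apply: (le_trans y12); rewrite exprS; have := ler_wpM2l (ltW e0) e4.
  by nra.
have d1 : x2 * y1 - x1 * y2 <= x2 * (e / 9 * y2) by nra.
have d0 : 0 <= x2 * y1 - x1 * y2 by rewrite subr_ge0.
rewrite ler_pdivrMr ?mulr_gt0//.
apply: (@le_trans _ _ ((x2 * (e / 9 * y2)) ^+ 2)).
  by rewrite lerXn2r// nnegrE//; exact: le_trans d1.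
rewrite (_ : _ ^+ 2 = e * (e / 81) * x2 ^+ 2 * y2 ^+ 2); last by field.
have X : x2 ^+ 2 <= (x1 + x2) ^+ 2 / 4 by nra.
have Y : y2 ^+ 2 <= y1 * y2 by rewrite expr2 ler_wpM2r// ltW.
have A : e * (e / 81) <= e / 243 by nra.
have A0 : 0 <= e * (e / 81) by rewrite mulr_ge0 ?divr_ge0 ?(ltW e0).
have B := sqr_ge0 (x1 + x2).
have C : e * (e / 81) * x2 ^+ 2 <= e / 400 * (x1 + x2) ^+ 2.
  apply: (@le_trans _ _ (e / 243 * ((x1 + x2) ^+ 2 / 4))).
    by apply: ler_pM; [|exact: sqr_ge0| |].
  by have := mulr_ge0 (ltW e0) B; lra.
apply: ler_pM; [exact: mulr_ge0 A0 (sqr_ge0 x2)|exact: sqr_ge0|exact: C|exact: Y].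
Qed.

(** With mean [mu] and raw moments [s], [m3], [m4], this compares the fourth central moment with the
    squared variance. As [0 <= mu * m3], the term in [m3] only helps; the other corrections are of
    order [mu ^+ 2], well within the slack between [8 * e / 100] and [e / 20]. *)
Lemma central_kurtosis (e k s m4 m3 mu : R) : 0 < e <= 1 / 3 -> 1 <= k -> 1 <= s ->
  `|mu| <= e ^+ 4 / 4 -> 0 <= mu * m3 -> m4 <= k * (1 - 9 * e / 100) * (1 + e / 400) * s ^+ 2 ->
  0 < s - mu ^+ 2 /\
  m4 - 4 * mu * m3 + 6 * mu ^+ 2 * s - 3 * mu ^+ 4 <= k * (1 - e / 20) * (s - mu ^+ 2) ^+ 2.
Proof.
move=> /andP[e0 e3] k1 s1 mue mum3 hm4.
have e4 : e ^+ 4 <= e / 27 by apply: eps_pow4_le; rewrite e0.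
have m1 : `|mu| <= e / 108 by lra.
have m2 : mu ^+ 2 <= e / 1000.
  rewrite -real_normK ?num_real//; have := normr_ge0 mu.
  move: (`|mu|) m1 => u u1 u0; nra.
have m20 := sqr_ge0 mu.
split; first by lra.
have -> : mu ^+ 4 = (mu ^+ 2) ^+ 2 by rewrite -exprM.
move: (mu ^+ 2) m2 m20 => w w1 w0.
have w2 := sqr_ge0 w.
apply: (@le_trans _ _ (k * (1 - 8 * e / 100) * s ^+ 2 + 6 * w * s)).
  have : k * (1 - 9 * e / 100) * (1 + e / 400) * s ^+ 2 <= k * (1 - 8 * e / 100) * s ^+ 2.
    rewrite ler_wpM2r ?sqr_ge0// -mulrA ler_wpM2l//; [lra|nra].
  by lra.
have ks : s <= k * s ^+ 2.
  have : s <= s ^+ 2 by nra.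
  have := sqr_ge0 s; nra.
apply: (@le_trans _ _ (k * (1 - e / 20) * (s ^+ 2 - 2 * w * s))); last first.
  rewrite ler_wpM2l//; first by apply: mulr_ge0; lra.
  by nra.
have h : 6 * w * s <= 6 * (e / 1000) * (k * s ^+ 2).
  by apply: ler_pM; rewrite ?mulr_ge0//; lra.
have h' : k * (1 - e / 20) * (2 * w * s) <= k * (2 * (e / 1000) * s ^+ 2).
  rewrite -mulrA ler_wpM2l//; first by lra.
  have : 2 * w * s <= 2 * (e / 1000) * s ^+ 2 by apply: ler_pM; rewrite ?mulr_ge0//; nra.
  have : 0 <= 2 * w * s by rewrite !mulr_ge0//; lra.
  by nra.
have : 0 <= k * s ^+ 2 by rewrite mulr_ge0 ?sqr_ge0//; lra.
by nra.
Qed.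

End BandArithmetic.

Section RemoveBand.
Context {R : realType}.
Implicit Types (q : R -> R) (Q : probability (measurableTypeR R) R).

Definition off_band (a b x : R) : R := (x \notin `[a, b])%:R.

Lemma measurable_off_band (a b : R) : measurable_fun setT (off_band a b).
Proof.
rewrite (_ : off_band a b = \1_(~` `[a, b]%classic : set R)).
  by apply: measurable_indic; apply: measurableC; exact: measurable_itv.
by apply/funext => x; rewrite indicE in_setC mem_setE.
Qed.

Lemma off_bandE (a b x : R) : a <= b -> off_band a b x = tail b x + tail (- a) (- x).
Proof.
move=> ab; rewrite /off_band /tail in_itv/= ltrN2.
case: (leP a x) => h1; case: (leP x b) => h2 /=; rewrite ?addr0 ?add0r//.
by exfalso; lra.
Qed.

Lemma has_density_remove_band Q q (a b : R) : has_density Q q ->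
  (0 < Q (~` `[a, b]%classic))%E ->
  has_density (remove_band Q a b)
    (fun x => q x * off_band a b x / fine (Q (~` `[a, b]%classic))).
Proof.
move=> [mq q0 Qq] Q0; set M := fine _.
have mab := measurable_itvccC a b.
have Qfin : (Q (~` `[a, b]%classic) \is a fin_num)%E by exact: fin_num_measure.
have M0 : 0 < M by rewrite fine_gt0// Q0 ltey_eq Qfin.
have mo := measurable_off_band a b.
split.
- by apply: measurable_funM => //; exact: measurable_funM.
- by move=> x; rewrite divr_ge0 ?mulr_ge0 ?ler0n// ltW.
move=> A mA; pose D : set (measurableTypeR R) := ~` `[a, b]%classic.
have -> : (remove_band Q a b A = if (Q (setT `&` D) == 0) || (Q (setT `&` D) == +oo)
    then Q A else Q (A `&` D) * ((fine (Q (setT `&` D)))^-1)%:E)%E.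
  by rewrite /remove_band /= /mnormalize; case: ifP.
rewrite setTI /D.
have QN0 : (Q (~` `[a, b]%classic) == 0%E) = false by rewrite gt_eqF.
have QNy : (Q (~` `[a, b]%classic) == +oo%E) = false by rewrite lt_eqF// ltey_eq Qfin.
rewrite QN0 QNy /= Qq; last exact: measurableI.
rewrite integral_mkcondr muleC -ge0_integralZl//.
- apply: eq_integral => x _; rewrite /patch /off_band.
  have -> : (x \in ~` `[a, b]%classic) = (x \notin `[a, b]).
    by rewrite in_setC mem_setE.
  by case: ifP => _; rewrite ?mulr1 ?mulr0 ?mul0r ?mule0// -EFinM mulrC.
- apply: measurable_funTS; apply: (iffLR (measurable_restrictT _ mab)).
  exact/measurable_funTS/measurable_EFinP.
- by move=> x _; rewrite /patch; case: ifP => // _; rewrite lee_fin.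
- by rewrite lee_fin invr_ge0 ltW.
Qed.

Lemma lint_off_band (f : R -> R) (a b : R) : a <= b -> integ f ->
  integ (fun x => f x * off_band a b x) /\
  lint (fun x => f x * off_band a b x) =
    lint (fun x => f x * tail b x) + lint (fun x => f (- x) * tail (- a) x).
Proof.
move=> ab fi; have fNi := integ_opp _ fi.
have h1 := integ_tail _ b fi; have h2 := integ_tail _ (- a) fNi.
have h3 := integ_opp _ h2.
have E x : f x * off_band a b x = f x * tail b x + f (- - x) * tail (- a) (- x).
  by rewrite off_bandE// opprK mulrDr.
split.
  rewrite (_ : (fun x => _) = (fun x => f x * tail b x + f (- - x) * tail (- a) (- x))).
    exact: integD.
  exact/funext.
by rewrite (eq_lint _ _ E) lintD// -(lint_opp _ h2).
Qed.

End RemoveBand.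

(** * Moments under centering and scaling *)

Section Standardize.
Context {R : realType}.
Variable P : probability (measurableTypeR R) R.
Local Notation T k := (\int[P]_x (x ^+ k)).

Lemma Rintegral_poly (c : nat -> R) n :
  (forall k, (k < n)%N -> P.-integrable setT (EFin \o (fun x : R => x ^+ k))) ->
  P.-integrable setT (EFin \o (fun x : R => \sum_(k < n) c k * x ^+ k)) /\
  \int[P]_x (\sum_(k < n) c k * x ^+ k) = \sum_(k < n) c k * T k.
Proof.
elim: n => [|n IH] iP.
  have E : (fun x : R => \sum_(k < 0) c k * x ^+ k) = fun=> 0.
    by apply/funext => x; rewrite big_ord0.
  by rewrite E big_ord0 /Rintegral integral0; split => //; exact: integrable0.
have [i1 I1] := IH (fun k kn => iP k (ltnW kn)).
have i2 : P.-integrable setT (EFin \o (fun x : R => c n * x ^+ n)).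
  by apply: eq_integrable (integrableZl measurableT (c n) (iP n (ltnSn n))).
split.
  apply: eq_integrable (integrableD measurableT i1 i2) => // x _ /=.
  by rewrite big_ord_recr EFinD.
rewrite big_ord_recr/= -I1 -RintegralZl//; last exact: iP.
rewrite -RintegralD//; apply: eq_Rintegral => x _.
by rewrite big_ord_recr.
Qed.

Hypothesis iP : forall k, (k <= 4)%N -> P.-integrable setT (EFin \o (fun x : R => x ^+ k)).

Let T0 : T 0 = 1.
Proof.
rewrite (@eq_Rintegral _ _ _ P _ (fun _ => 1)) ?Rintegral_cst// ?mul1r.
  by rewrite [X in fine X](_ : _ = 1%E)//; exact: probability_setT.
Qed.

Lemma Rintegral_sqr_centered (m : R) :
  P.-integrable setT (EFin \o (fun x : R => (x - m) ^+ 2)) /\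
  \int[P]_x ((x - m) ^+ 2) = T 2 - 2 * m * T 1 + m ^+ 2.
Proof.
pose c k := [:: m ^+ 2; - (2 * m); 1]`_k.
have E x : (x - m) ^+ 2 = \sum_(k < 3) c k * x ^+ k.
  by rewrite !big_ord_recl big_ord0 /c /=; ring.
have [i I] := Rintegral_poly c 3 (fun k k3 => iP k (leq_trans k3 (isT : (3 <= 5)%N))).
split; first by under eq_fun do rewrite E.
rewrite (@eq_Rintegral _ _ _ P _ (fun x => \sum_(k < 3) c k * x ^+ k)); last by move=> x _; exact: E.
by rewrite I !big_ord_recl big_ord0 /c /= T0; ring.
Qed.

Lemma Rintegral_pow4_centered (m : R) :
  P.-integrable setT (EFin \o (fun x : R => (x - m) ^+ 4)) /\
  \int[P]_x ((x - m) ^+ 4) =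
    T 4 - 4 * m * T 3 + 6 * m ^+ 2 * T 2 - 4 * m ^+ 3 * T 1 + m ^+ 4.
Proof.
pose c k := [:: m ^+ 4; - (4 * m ^+ 3); 6 * m ^+ 2; - (4 * m); 1]`_k.
have E x : (x - m) ^+ 4 = \sum_(k < 5) c k * x ^+ k.
  by rewrite !big_ord_recl big_ord0 /c /=; ring.
have [i I] := Rintegral_poly c 5 (fun k k5 => iP k k5).
split; first by under eq_fun do rewrite E.
rewrite (@eq_Rintegral _ _ _ P _ (fun x => \sum_(k < 5) c k * x ^+ k)); last by move=> x _; exact: E.
by rewrite I !big_ord_recl big_ord0 /c /= T0; ring.
Qed.

Lemma expectation_idE : fine 'E_P[idfun] = T 1.
Proof.
by rewrite unlock /Rintegral; congr fine; apply: eq_integral => x _; rewrite expr1.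
Qed.

Lemma variance_idE : fine 'V_P[idfun] = T 2 - T 1 ^+ 2.
Proof.
rewrite /variance unlock expectation_idE unlock.
have [_ E] := Rintegral_sqr_centered (T 1).
transitivity (\int[P]_x ((x - T 1) ^+ 2)); last by rewrite E; ring.
by rewrite /Rintegral; congr fine; apply: eq_integral => x _; rewrite expr2.
Qed.

Lemma isotropize_moments : 0 < T 2 - T 1 ^+ 2 ->
  [/\ (isotropize P).-integrable setT (EFin \o (fun x : R => x ^+ 2)),
      (isotropize P).-integrable setT (EFin \o (fun x : R => x ^+ 4)),
      \int[isotropize P]_x (x ^+ 2) = 1 &
      \int[isotropize P]_x (x ^+ 4) =
        (T 4 - 4 * T 1 * T 3 + 6 * T 1 ^+ 2 * T 2 - 3 * T 1 ^+ 4) /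
        (T 2 - T 1 ^+ 2) ^+ 2].
Proof.
set V := _ - _ => V0; have sV : Num.sqrt V ^+ 2 = V by rewrite sqr_sqrtr// ltW.
have V_neq0 : V != 0 by rewrite gt_eqF.
have isoE : isotropize P = distribution P (standardize (T 1) (Num.sqrt V)).
  by rewrite /isotropize variance_idE expectation_idE.
have i2 : P.-integrable setT
    (EFin \o (fun x : R => x ^+ 2) \o standardize (T 1) (Num.sqrt V)).
  have [i _] := Rintegral_sqr_centered (T 1).
  apply: eq_integrable (integrableZl measurableT V^-1 i) => // x _ /=.
  by rewrite /standardize expr_div_n sV -EFinM mulrC.
have i4 : P.-integrable setT
    (EFin \o (fun x : R => x ^+ 4) \o standardize (T 1) (Num.sqrt V)).
  have [i _] := Rintegral_pow4_centered (T 1).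
  apply: eq_integrable (integrableZl measurableT (V ^+ 2)^-1 i) => // x _ /=.
  by rewrite /standardize expr_div_n (exprM (Num.sqrt V) 2 2) sV -EFinM mulrC.
have ms := measurable_standardize (T 1) (Num.sqrt V).
have mX k : measurable_fun setT (EFin \o (fun x : R => x ^+ k)).
  by apply/measurable_EFinP; exact: exprn_measurable.
rewrite isoE; split.
- exact: (integrable_pushforward ms (mX 2) i2 measurableT).
- exact: (integrable_pushforward ms (mX 4) i4 measurableT).
- have [i E] := Rintegral_sqr_centered (T 1).
  rewrite [LHS]/Rintegral integral_distribution; [|exact: (mX 2)|exact: i2].
  rewrite (_ : integral _ _ _ = \int[P]_x (V^-1 * (x - T 1) ^+ 2)%:E)%E; last first.
    by apply: eq_integral => x _ /=; rewrite /standardize expr_div_n sV mulrC.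
  rewrite -[LHS]/(\int[P]_x (V^-1 * (x - T 1) ^+ 2)) RintegralZl// E.
  by rewrite (_ : _ - _ + _ = V) ?mulVf// /V; ring.
have [i E] := Rintegral_pow4_centered (T 1).
rewrite [LHS]/Rintegral integral_distribution; [|exact: (mX 4)|exact: i4].
rewrite (_ : integral _ _ _ = \int[P]_x ((V ^+ 2)^-1 * (x - T 1) ^+ 4)%:E)%E; last first.
  by apply: eq_integral => x _ /=; rewrite /standardize expr_div_n (exprM (Num.sqrt V) 2 2) sV mulrC.
rewrite -[LHS]/(\int[P]_x ((V ^+ 2)^-1 * (x - T 1) ^+ 4)) RintegralZl// E mulrC.
by congr (_ / _); ring.
Qed.

End Standardize.

Section IsotropicDensity.
Context {R : realType}.
Variables (q : R -> R) (Q : probability (measurableTypeR R) R).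
Hypothesis dq : has_density Q q.

Let mq : measurable_fun setT q. Proof. by case: dq. Qed.
Let q_ge0 x : 0 <= q x. Proof. by case: dq. Qed.
Let iq : integ q. Proof. exact: density_integrable dq. Qed.

Lemma lint_density : lint q = 1.
Proof.
case: dq => _ _ /(_ _ measurableT); rewrite probability_setT => E.
by rewrite /Rintegral -E.
Qed.

Lemma isotropic_sqr : isotropic Q ->
  integ (fun x : R => x ^+ 2 * q x) /\ lint (fun x : R => x ^+ 2 * q x) = 1.
Proof.
move=> [EQ VQ]; have mX := @exprn_measurable R setT 2.
have E : (\int[leb]_x (x ^+ 2 * q x)%:E = 1)%E.
  rewrite -VQ /variance unlock EQ unlock.
  rewrite (@ge0_integral_density _ _ _ _ dq).
  - apply: eq_integral => x _; rewrite [in LHS](_ : x ^+ 2 = (x - 0) * (x - 0)); last by rewrite subr0 expr2.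
    by rewrite EFinM.
  - apply/measurable_EFinP.
    rewrite -[X in measurable_fun _ X]/(fun x : R => (x - 0) * (x - 0)).
    by apply: measurable_funM; exact: measurable_funB.
  - by move=> x; rewrite lee_fin; exact: (sqr_ge0 (x - 0)).
split; last by rewrite /Rintegral E.
apply/integ_ge0P; first exact: measurable_funM.
  by move=> x; rewrite mulr_ge0// sqr_ge0.
by rewrite E ltry.
Qed.

Lemma density_measureE (A : set (measurableTypeR R)) : measurable A ->
  integ (fun x => q x * \1_A x) /\ Q A = (lint (fun x => q x * \1_A x))%:E.
Proof.
move=> mA; have ii : integ (fun x => q x * \1_A x).
  apply: (integ_dom _ q) => //.
    by apply: measurable_funM => //; exact: measurable_indic.
  by move=> x; rewrite normrM ger0_norm// ger0_norm// ler_piMr// indicE lern1 leq_b1.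
split=> //; case: dq => _ _ Qq; rewrite Qq//.
rewrite /Rintegral fineK; last exact: integrable_fin_num ii.
rewrite [LHS]integral_mkcond; apply: eq_integral => x _.
by rewrite /patch indicE; case: (x \in A); rewrite ?mulr1 ?mulr0.
Qed.

Hypothesis q_sym : symmetric_density q.
Local Notation mom := (tail_moment q).

Let integ_pt (c : R) : integ (fun x => q x * (x == c)%:R).
Proof.
have [+ _] := density_measureE [set c] (measurable_set1 c).
apply: eq_integrable => // x _ /=; congr (EFin (_ * _)); rewrite indicE.
have [->|xc] := eqVneq x c; first by rewrite mem_set.
by rewrite memNset//; exact/eqP.
Qed.

Lemma density_itvcy (b : R) : Q `[b, +oo[%classic = (mom 0 b)%:E.
Proof.
have [ii ->] := density_measureE `[b, +oo[%classic (measurable_itv _).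
congr EFin; rewrite -[RHS]addr0 -(lint_point b q) -lintD//; last first.
  by apply: integ_tail; under eq_fun do rewrite expr0 mul1r.
apply: eq_lint => x; rewrite indicE mem_setE in_itv/= andbT expr0 mul1r -mulrDr.
by congr (_ * _); rewrite /tail; case: ltgtP => //=; rewrite ?addr0 ?add0r.
Qed.

Lemma density_itvyc (a : R) : Q `]-oo, a]%classic = (mom 0 (- a))%:E.
Proof.
have [ii ->] := density_measureE `]-oo, a]%classic (measurable_itv _).
have it : integ (fun x : R => x ^+ 0 * q x * tail (- a) x).
  by apply: integ_tail; under eq_fun do rewrite expr0 mul1r.
have itN := integ_opp _ it.
have -> : mom 0 (- a) = lint (fun x : R => (- x) ^+ 0 * q (- x) * tail (- a) (- x)).
  exact: lint_opp it.
congr EFin; rewrite -[RHS]addr0 -(lint_point a q) -lintD//.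
apply: eq_lint => x; rewrite indicE mem_setE in_itv/= expr0 mul1r q_sym -mulrDr.
by congr (_ * _); rewrite /tail ltrN2; case: ltgtP => //=; rewrite ?addr0 ?add0r.
Qed.

Lemma density_itvC (a b : R) : a <= b ->
  Q (~` `[a, b]%classic) = (mom 0 b + mom 0 (- a))%:E.
Proof.
move=> ab; have mab := measurable_itvccC a b.
have [ii ->] := density_measureE _ mab.
have [_ E] := lint_off_band q a b ab iq.
rewrite (eq_lint _ (fun x => q x * off_band a b x)); last first.
  by move=> x; rewrite indicE /off_band in_setC mem_setE.
rewrite E; congr (EFin (_ + _)); apply: eq_lint => x; rewrite expr0 mul1r//.
by rewrite q_sym.
Qed.

(** Read backwards, it bounds the length of a band from below by its mass divided by [K]. *)
Lemma density_itvcc_le (a b K : R) : a <= b -> (forall x, q x <= K) ->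
  (Q `[a, b]%classic <= (K * (b - a))%:E)%E.
Proof.
move=> ab qK; have [ii ->] := density_measureE `[a, b]%classic (measurable_itv _).
have [ik Ik] := integ_itv K _ _ ab.
rewrite lee_fin -Ik -[leRHS]addr0 -(lint_point a q) -lintD//.
apply: le_lint => //; first exact: integD.
move=> x; rewrite indicE mem_setE in_itv/= tailB//.
have qx := q_ge0 x; have qKx := qK x.
have [->|xa] := eqVneq x a; first by rewrite lexx ab ltxx /= !mulr1 mulr0 add0r.
rewrite mulr0 addr0 (lt_neqAle a) eq_sym xa /=.
by case: (_ && _); rewrite ?mulr1 ?mulr0.
Qed.

End IsotropicDensity.

Section BandKurtosis.
Context {R : realType}.
Variable q : R -> R.
Hypotheses (mq : measurable_fun setT q) (q_ge0 : forall x, 0 <= q x)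
  (q_sym : symmetric_density q) (q_lc : logconcave q)
  (iq : integ q) (Iq : lint q = 1)
  (i2 : integ (fun x : R => x ^+ 2 * q x)) (I2 : lint (fun x : R => x ^+ 2 * q x) = 1)
  (ik : forall k, (k <= 4)%N -> integ (fun x : R => x ^+ k * q x)).
Local Notation mom := (tail_moment q).

(** Here [t1] and [t2] stand for [b] and [- a] in increasing order. The conclusions are what
    [central_kurtosis] consumes: the kurtosis about 0, the size of the mean, and first and third
    moments of the same sign. *)
Lemma band_moments_le (e t1 t2 : R) : 0 < e <= 1 / 3 -> 0 < t1 <= t2 ->
  t2 - t1 <= e ^+ 5 -> e <= mom 0 t2 -> mom 0 t1 + mom 0 t2 <= 1 - e ->
  [/\ (mom 4 t1 + mom 4 t2) * (mom 0 t1 + mom 0 t2) <=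
        2 * mom 4 0 * (1 - 9 * e / 100) * (1 + e / 400) * (mom 2 t1 + mom 2 t2) ^+ 2,
      0 <= mom 1 t1 - mom 1 t2 <= e ^+ 4 / 4 * (mom 0 t1 + mom 0 t2) &
      0 <= mom 3 t1 - mom 3 t2].
Proof.
move=> e13 /andP[t10 t12] de ey ysum.
have /andP[e0 e3] := e13.
have t20 : 0 < t2 by exact: lt_le_trans t12.
have t12' : 0 <= t1 <= t2 by rewrite (ltW t10).
have y21 := mom_nincr q q_ge0 ik 0 t1 t2 isT t12'.
have y20 : 0 < mom 0 t2 by exact: lt_le_trans ey.
have y10 : 0 < mom 0 t1 by exact: lt_le_trans y21.
have x21 := mom_nincr q q_ge0 ik 2 t1 t2 isT t12'.
have x20 := mom_ge0 q q_ge0 2 t2 (ltW t20).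
have v21 := mom_nincr q q_ge0 ik 1 t1 t2 isT t12'.
have w21 := mom_nincr q q_ge0 ik 3 t1 t2 isT t12'.
have rm := ratio_mono q q_ge0 ik t1 t2 t12'.
have q3 := q0_le q mq q_ge0 q_sym q_lc iq Iq i2 I2.
have /andP[_ yb] := mom0_band q q_ge0 q_sym q_lc ik t1 t2 t12'.
have vb := mom1_band q q_ge0 q_sym q_lc iq Iq ik t1 t2 t12'.
have g1 := kurtosis_gap q q_ge0 q_sym q_lc iq Iq i2 I2 ik t1 t10 y10.
have g2 := kurtosis_gap q q_ge0 q_sym q_lc iq Iq i2 I2 ik t2 t20 y20.
have m4 := mom4_ge q q_ge0 q_sym iq Iq i2 I2 ik.
have e4 := eps_pow4_le e e13.
have e5 : e ^+ 5 <= e / 81.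
  by clear rm g1 g2 vb yb x21 v21 w21 de q3 x20; rewrite exprS; have := ler_wpM2l (ltW e0) e4; nra.
have y12 : mom 0 t1 - mom 0 t2 <= 3 * e ^+ 5.
  have qt1 : q t1 <= 3 by apply: le_trans q3; apply: logconcave_nincr => //; rewrite lexx ltW.
  by apply: (le_trans yb); apply: ler_pM => //; rewrite subr_ge0.
(* As [mom 0 t1 - mom 0 t2 <= e / 27], both symmetric bands [[-t1, t1]] and [[-t2, t2]] have mass at
   least [26/27 * e], and [3/32 * 26/27 >= 9/100]. *)
have gap t : 26 / 27 * e <= 1 - 2 * mom 0 t -> 0 <= mom 2 t ->
    mom 4 t * mom 0 t <= 2 * mom 4 0 * (1 - 3 / 32 * (1 - 2 * mom 0 t)) * mom 2 t ^+ 2 ->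
    mom 4 t * mom 0 t <= 2 * mom 4 0 * (1 - 9 * e / 100) * mom 2 t ^+ 2.
  move=> h1 h2 h3; apply: (le_trans h3); apply: ler_wpM2r; first exact: sqr_ge0.
  by clear rm g1 g2 vb yb x21 v21 w21 de q3 y12 y21 ysum ey e5 x20 h3 h2; apply: ler_wpM2l; lra.
split.
- apply: mixed_kurtosis => //.
  + by clear rm g1 g2 vb yb x21 v21 w21 de q3 y12 y21 ysum ey e5 x20; lra.
  + by clear rm g1 g2 vb yb x21 v21 w21 de q3 y12 y21 ysum ey e5 x20; apply/andP; split; lra.
  + by rewrite ey.
  + by rewrite x20.
  + by apply: gap => //; [clear rm g1 g2 vb yb x21 v21 w21 de q3 ; lra|exact: le_trans x21].
  + by apply: gap => //; clear rm g1 g2 vb yb x21 v21 w21 de q3 ; lra.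
- rewrite subr_ge0 v21 /=; apply: (le_trans vb).
  (* The two tails have total mass at least [2 * e], which absorbs one power of [e] from
     [t2 - t1 <= e ^+ 5]. *)
  apply: (@le_trans _ _ (e ^+ 4 / 4 * (2 * e))); last first.
    by apply: ler_wpM2l; [rewrite divr_ge0// exprn_ge0// ltW|clear rm g1 g2 gap; lra].
  by clear rm g1 g2 gap; move: de; rewrite exprSr; lra.
- by rewrite subr_ge0.
Qed.

End BandKurtosis.

(** * Moments of [q] and of [q^] *)

Section HatMoments.
Context {R : realType}.
Variables (q : R -> R) (Q : probability (measurableTypeR R) R).
Hypotheses (dq : has_density Q q) (q_sym : symmetric_density q)
  (q_iso : isotropic Q) (q_lc : logconcave q).
Local Notation mom := (tail_moment q).

Let mq : measurable_fun setT q. Proof. by case: dq. Qed.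
Let q_ge0 x : 0 <= q x. Proof. by case: dq. Qed.
Let iq : integ q. Proof. exact: density_integrable dq. Qed.
Let Iq : lint q = 1. Proof. exact: lint_density dq. Qed.
Let i2 : integ (fun x : R => x ^+ 2 * q x).
Proof. by have [] := isotropic_sqr q Q dq q_iso. Qed.
Let I2 : lint (fun x : R => x ^+ 2 * q x) = 1.
Proof. by have [] := isotropic_sqr q Q dq q_iso. Qed.

(** The bound of [sixth_moment] at the least admissible [D], namely [256 * 3]. *)
Definition sixth_bound : R := 2 * (2 * (256 * 3)) ^+ 6.

Lemma sixth_bound_ge0 : 0 <= sixth_bound.
Proof. by apply: mulr_ge0; [exact: ler0n|exact: exprn_even_ge0]. Qed.

Let i6 : integ (fun x : R => x ^+ 6 * q x) /\ lint (fun x : R => x ^+ 6 * q x) <= sixth_bound.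
Proof. exact: (sixth_moment q mq q_ge0 q_sym q_lc iq Iq i2 I2 _ (lexx _)). Qed.

Let ik k : (k <= 6)%N -> integ (fun x : R => x ^+ k * q x).
Proof.
move=> k6; have [j6 _] := i6.
apply: (integ_dom _ (fun x => q x + x ^+ 6 * q x)); last 1 first.
- move=> x; rewrite normrM (ger0_norm (q_ge0 x)) normrX.
  rewrite -[X in _ <= X + _]mul1r -mulrDl ler_wpM2r//.
  have -> : x ^+ 6 = `|x| ^+ 6 by rewrite -normrX ger0_norm// exprn_even_ge0.
  have [x1|x1] := leP `|x| 1.
    by apply: (@le_trans _ _ 1); rewrite ?exprn_ile1// lerDl exprn_ge0.
  by apply: (@le_trans _ _ (`|x| ^+ 6)); rewrite ?lerDr// ler_weXn2l// ltW.
- by apply: measurable_funM => //; exact: exprn_measurable.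
- exact: integD.
Qed.

Let ik4 k (k4 : (k <= 4)%N) := ik k (leq_trans k4 (isT : (4 <= 6)%N)).

Lemma density_moment k : (k <= 6)%N ->
  Q.-integrable setT (EFin \o (fun x : R => x ^+ k)) /\
  \int[Q]_x (x ^+ k) = lint (fun x : R => x ^+ k * q x).
Proof.
move=> k6; split.
  by apply: (integ_density _ _ _ dq); [exact: exprn_measurable|exact: ik].
by apply: (Rintegral_density _ _ _ dq); [exact: exprn_measurable|exact: ik].
Qed.

Lemma density_sixth : lint (fun x : R => x ^+ 6 * q x) <= sixth_bound.
Proof. by have [] := i6. Qed.

Lemma density_fourth : \int[Q]_x (x ^+ 4) = 2 * mom 4 0.
Proof.
have [_ ->] := density_moment 4 isT; apply: lint_even; first exact: ik.
by move=> x; rewrite q_sym exprNn (_ : (-1) ^+ 4 = 1) ?mul1r//; ring.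
Qed.

Lemma density_odd (f : R -> R) : (forall x, f (- x) = - f x) -> measurable_fun setT f ->
  (exists M, forall x, `|f x| <= M) -> \int[Q]_x f x = 0.
Proof.
move=> fN mf [M fM].
have ii : integ (fun x => f x * q x).
  apply: (integ_dom _ (fun x => M * q x)); first exact: measurable_funM.
    exact: integZ.
  by move=> x; rewrite normrM (ger0_norm (q_ge0 x)) ler_wpM2r.
rewrite (Rintegral_density _ _ _ dq)//.
have E : lint (fun x => f x * q x) = - 1 * lint (fun x => f x * q x).
  by rewrite {1}lint_opp// -lintZ//; apply: eq_lint => x; rewrite fN q_sym mulN1r mulNr.
by lra.
Qed.

Variables (e a b : R).
Hypotheses (e0 : 0 < e) (ab : a < b)
  (Qa : (e%:E <= Q `]-oo, a]%classic)%E)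
  (Qab : (e%:E <= Q `[a, b]%classic)%E)
  (Qb : (e%:E <= Q `[b, +oo[%classic)%E)
  (abe : `|a + b| < e ^+ 5).

Let y_b : e <= mom 0 b.
Proof. by move: Qb; rewrite (density_itvcy q Q dq) lee_fin. Qed.

Let y_a : e <= mom 0 (- a).
Proof. by move: Qa; rewrite (density_itvyc q Q dq q_sym) lee_fin. Qed.

Let y_ab : mom 0 b + mom 0 (- a) <= 1 - e.
Proof.
have mab := measurable_itvccC a b.
have := probability_setC Q (measurable_itv `[a, b]).
rewrite (density_itvC q Q dq q_sym a b (ltW ab)) => E.
have Qfin : Q `[a, b]%classic \is a fin_num by exact: fin_num_measure.
move: Qab E; rewrite -(fineK Qfin) lee_fin -EFinB => h [->].
by rewrite lerD2l lerN2.
Qed.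

Lemma eps_le : e <= 1 / 3. Proof. by have := y_a; have := y_b; have := y_ab; lra. Qed.

Let e13 : 0 < e <= 1 / 3. Proof. by rewrite e0 eps_le. Qed.

(** Since [q <= 3], a band of mass at least [e] has length at least [e / 3], while
    [|a + b| < e ^+ 5 <= e / 81]; the end points must have opposite signs. *)
Let ab0 : a < 0 < b.
Proof.
have qK x : q x <= 3.
  apply: le_trans (q0_le q mq q_ge0 q_sym q_lc iq Iq i2 I2).
  exact: q_le_max q_ge0 q_sym q_lc x.
have := le_trans Qab (density_itvcc_le q Q dq a b 3 (ltW ab) qK).
rewrite lee_fin => eab; have e4 := eps_pow4_le e e13.
have e3 := eps_le.
have e5 : e ^+ 5 <= e / 81.
  by rewrite exprS; have := ler_wpM2l (ltW e0) e4; nra.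
move: abe; rewrite ltr_norml => /andP[h1 h2].
by apply/andP; split; lra.
Qed.

Let M := mom 0 b + mom 0 (- a).

Lemma band_moments :
  [/\ (mom 4 b + mom 4 (- a)) * M <=
        2 * mom 4 0 * (1 - 9 * e / 100) * (1 + e / 400) * (mom 2 b + mom 2 (- a)) ^+ 2,
      `|mom 1 b - mom 1 (- a)| <= e ^+ 4 / 4 * M &
      0 <= (mom 1 b - mom 1 (- a)) * (mom 3 b - mom 3 (- a))].
Proof.
have /andP[a0 b0] := ab0; rewrite /M.
move: abe; rewrite ltr_norml => /andP[h1 h2].
have BL := band_moments_le q mq q_ge0 q_sym q_lc iq Iq i2 I2 ik4 e.
(* By reflection the left tail is a right tail cut at [- a], and the smaller of [b] and [- a] plays
   [t1]. Exchanging them flips both odd differences, so their product keeps its sign. *)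
have [ba|ba] := leP b (- a).
  have h : 0 < b <= - a by rewrite b0.
  have d : - a - b <= e ^+ 5 by lra.
  have [c1 /andP[c2 c3] c4] := BL b (- a) e13 h d y_a y_ab.
  by split=> //; [rewrite ger0_norm|exact: mulr_ge0].
have h : 0 < - a <= b by rewrite oppr_gt0 a0 ltW.
have d : b - - a <= e ^+ 5 by lra.
have y_ba : mom 0 (- a) + mom 0 b <= 1 - e by rewrite addrC.
have [c1 /andP[c2 c3] c4] := BL (- a) b e13 h d y_b y_ba.
split.
- by rewrite addrC (addrC (mom 0 b)) (addrC (mom 2 b)).
- by rewrite distrC ger0_norm// (addrC (mom 0 b)).
- by rewrite -mulrNN !opprB mulr_ge0.
Qed.

Local Notation T k := (\int[remove_band Q a b]_x (x ^+ k)).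

Lemma remove_band_moment k : (k <= 4)%N ->
  (remove_band Q a b).-integrable setT (EFin \o (fun x : R => x ^+ k)) /\
  T k = (mom k b + (-1) ^+ k * mom k (- a)) / M.
Proof.
move=> k4; have QC := density_itvC q Q dq q_sym a b (ltW ab).
have M0 : 0 < M by rewrite addr_gt0 ?(lt_le_trans e0 y_a) ?(lt_le_trans e0 y_b).
have Q0 : (0 < Q (~` `[a, b]%classic))%E by rewrite QC lte_fin.
have db := has_density_remove_band Q q a b dq Q0.
rewrite QC /= -/M in db.
have [io Io] := lint_off_band (fun x => x ^+ k * q x) a b (ltW ab) (ik4 k k4).
have E x : x ^+ k * (q x * off_band a b x / M) = M^-1 * (x ^+ k * q x * off_band a b x).
  by rewrite !mulrA mulrC !mulrA.
have ii : integ (fun x => x ^+ k * (q x * off_band a b x / M)).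
  by under eq_fun do rewrite E; exact: integZ.
have mX := @exprn_measurable R setT k.
split; first exact: (integ_density _ _ _ db).
rewrite (Rintegral_density _ _ _ db)// (eq_lint _ _ E) lintZ// Io mulrC; congr (_ / _).
congr (_ + _); rewrite /tail_moment -lintZ; last exact/integ_tail/ik4.
by apply: eq_lint => x; rewrite q_sym (exprNn x k) !mulrA.
Qed.

Lemma hat_moments : let Qhat := isotropize (remove_band Q a b) in
  [/\ Qhat.-integrable setT (EFin \o (fun x : R => x ^+ 2)),
      Qhat.-integrable setT (EFin \o (fun x : R => x ^+ 4)),
      \int[Qhat]_x (x ^+ 2) = 1 &
      \int[Qhat]_x (x ^+ 4) <= \int[Q]_x (x ^+ 4) * (1 - e / 20)].
Proof.
move=> Qhat.
have M0 : 0 < M by rewrite addr_gt0 ?(lt_le_trans e0 y_a) ?(lt_le_trans e0 y_b).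
have Tk k (k4 : (k <= 4)%N) := (remove_band_moment k k4).2.
have [b1 b2 b3] := band_moments.
have /andP[a0 b0] := ab0.
have T1 : T 1 = (mom 1 b - mom 1 (- a)) / M by rewrite Tk// expr1 mulN1r.
have T3 : T 3 = (mom 3 b - mom 3 (- a)) / M.
  by rewrite Tk// (_ : (-1) ^+ 3 = -1) ?mulN1r//; ring.
have T2 : T 2 = (mom 2 b + mom 2 (- a)) / M by rewrite Tk// sqrrN expr1n mul1r.
have T4 : T 4 = (mom 4 b + mom 4 (- a)) / M.
  by rewrite Tk// (_ : (-1) ^+ 4 = 1) ?mul1r//; ring.
have m4 := mom4_ge q q_ge0 q_sym iq Iq i2 I2 ik4.
have M1 : M != 0 by rewrite gt_eqF.
have [|||||V0 K] := central_kurtosis e (2 * mom 4 0) (T 2) (T 4) (T 3) (T 1) e13.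
- by lra.
- rewrite T2 ler_pdivlMr// mul1r /M lerD//; apply: mom2_ge_mom0 => //; rewrite ?oppr_ge0 ltW//.
- by rewrite T1 normrM normfV (gtr0_norm M0) ler_pdivrMr.
- by rewrite T1 T3 mulrACA mulr_ge0// -expr2 sqr_ge0.
- rewrite T2 T4 expr_div_n mulrA ler_pdivlMr ?exprn_gt0//.
  by rewrite (_ : _ / M * M ^+ 2 = (mom 4 b + mom 4 (- a)) * M)//; field.
have [j2 j4 J2 J4] := isotropize_moments (remove_band Q a b)
  (fun k k4 => (remove_band_moment k k4).1) V0.
split=> //; rewrite J4 density_fourth ler_pdivrMr ?exprn_gt0//.
Qed.

End HatMoments.

(** * Reweighted moments *)

Section Reweighting.
Context {R : realType}.

Lemma expRN_ge (u : R) : 1 - u <= expR (- u).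
Proof. exact: expR_ge1Dx. Qed.

(** From [e^u >= 1 + u] and [(1 + u) (1 - u + u^2) = 1 + u^3]. *)
Lemma expRN_le (u : R) : 0 <= u -> expR (- u) <= 1 - u + u ^+ 2.
Proof.
move=> u0; have u1 : 0 < 1 + u by lra.
apply: (@le_trans _ _ (1 + u)^-1).
  by rewrite expRN lef_pV2 ?posrE ?expR_gt0// expR_ge1Dx.
rewrite -[leLHS]mul1r ler_pdivrMr//.
by have := exprn_ge0 3 u0; nra.
Qed.

Variable P : probability (measurableTypeR R) R.
Local Notation intP f := (P.-integrable setT (EFin \o f)).
Local Notation monom k := (fun x : R => x ^+ k).

Definition weight (al x : R) := expR (al * x ^+ 2).

Lemma weight_gt0 al x : 0 < weight al x. Proof. exact: expR_gt0. Qed.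

Lemma weight_le1 al x : al <= 0 -> weight al x <= 1.
Proof. by move=> al0; rewrite -expR0 ler_expR mulr_le0_ge0// sqr_ge0. Qed.

Lemma measurable_weight al : measurable_fun setT (weight al).
Proof.
apply: measurableT_comp; first exact: measurable_expR.
by apply: measurable_funM => //; exact: exprn_measurable.
Qed.

Lemma weight_integrable al : al <= 0 -> intP (weight al).
Proof.
move=> al0; apply: (@bounded_integrable _ _ _ P _ 1); first exact: measurable_weight.
by move=> x; rewrite ger0_norm ?weight_le1// ltW// weight_gt0.
Qed.

Lemma sqr_weight_integrable al : al <= 0 -> intP (monom 2) ->
  intP (fun x => x ^+ 2 * weight al x).
Proof.
move=> al0 i2; apply: (@le_integrable _ _ _ P setT measurableT _ (EFin \o monom 2)) => //.
  apply/measurable_EFinP; apply: measurable_funM; [exact: exprn_measurable|exact: measurable_weight].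
move=> x _; rewrite lee_fin normrM ler_piMr// ger0_norm ?weight_le1//.
by rewrite ltW// weight_gt0.
Qed.

Let Rint_add f g : intP f -> intP g ->
  intP (fun x => f x + g x) /\ \int[P]_x (f x + g x) = \int[P]_x f x + \int[P]_x g x.
Proof.
move=> fi gi; split; last by rewrite RintegralD.
by apply: eq_integrable (integrableD measurableT fi gi).
Qed.

Let Rint_scale (c : R) f : intP f ->
  intP (fun x => c * f x) /\ \int[P]_x (c * f x) = c * \int[P]_x f x.
Proof.
move=> fi; split; last by rewrite RintegralZl.
by apply: eq_integrable (integrableZl measurableT c fi).
Qed.

Let Rint1 : intP (cst 1) /\ \int[P]_x (cst 1 x) = 1.
Proof.
split; first exact: finite_measure_integrable_cst.
rewrite Rintegral_cst// mul1r.
by rewrite [X in fine X](_ : _ = 1%E)//; exact: probability_setT.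
Qed.

Lemma partition_bounds (be : R) : 0 <= be -> intP (monom 2) -> intP (monom 4) ->
  \int[P]_x (x ^+ 2) = 1 ->
  1 - be <= \int[P]_x (weight (- be) x) <= 1 - be + be ^+ 2 * \int[P]_x (x ^+ 4) /\
  \int[P]_x (weight (- be) x) <= 1.
Proof.
move=> be0 i2 i4 E2; have al0 : - be <= 0 by lra.
have iw := weight_integrable _ al0.
have [j1 J1] := Rint1.
have [j2 J2] := Rint_scale (- be) (monom 2) i2.
have [j4 J4] := Rint_scale (be ^+ 2) (monom 4) i4.
have [k1 K1] := Rint_add _ _ j1 j2.
have [k2 K2] := Rint_add _ _ k1 j4.
have bx x : 0 <= be * x ^+ 2 by rewrite mulr_ge0// sqr_ge0.
split; last first.
  by rewrite -[leRHS]J1; apply: le_Rintegral => // x _; exact: weight_le1.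
apply/andP; split.
  have -> : 1 - be = \int[P]_x (cst 1 x + - be * x ^+ 2) by rewrite K1 J1 J2 E2 mulr1.
  apply: le_Rintegral => // x _.
  by rewrite /weight mulNr; exact: expRN_ge.
have -> : 1 - be + be ^+ 2 * \int[P]_x x ^+ 4 =
    \int[P]_x (cst 1 x + - be * x ^+ 2 + be ^+ 2 * x ^+ 4).
  by rewrite K2 K1 J1 J2 J4 E2 mulr1.
apply: le_Rintegral => // x _.
rewrite /weight !mulNr (exprM x 2 2) -exprMn.
exact: expRN_le.
Qed.

(** Pointwise [2 y - 1 <= y^2 <= 1 + y^3] with [y = x^2]. The upper bound lets a single constant,
    the bound on the sixth moment, control every error term. *)
Lemma fourth_moment_bounds : intP (monom 2) -> intP (monom 4) -> intP (monom 6) ->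
  \int[P]_x (x ^+ 2) = 1 ->
  1 <= \int[P]_x (x ^+ 4) /\ \int[P]_x (x ^+ 4) <= 1 + \int[P]_x (x ^+ 6).
Proof.
move=> i2 i4 i6 E2; have [j1 J1] := Rint1; have [j1' J1'] := Rint_scale (- 1) _ j1.
have [j2 J2] := Rint_scale 2 (monom 2) i2.
have [k1 K1] := Rint_add _ _ j2 j1'; have [k2 K2] := Rint_add _ _ j1 i6.
split.
  have -> : 1 = \int[P]_x (2 * x ^+ 2 + - 1 * cst 1 x) by rewrite K1 J1' J1 J2 E2; ring.
  apply: le_Rintegral => // x _.
  by have := sqr_ge0 (x ^+ 2 - 1); rewrite sqrrB1 -exprM /cst; lra.
rewrite -[X in _ <= X + _]J1 -K2; apply: le_Rintegral => // x _.
rewrite (exprM x 2 2) (exprM x 2 3) /cst; have := sqr_ge0 x.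
by move: (x ^+ 2) => y y0; have [y1|y1] := leP y 1; nra.
Qed.

Lemma second_moment_ge (be : R) : 0 <= be -> intP (monom 2) -> intP (monom 4) ->
  \int[P]_x (x ^+ 2) = 1 ->
  1 - be * \int[P]_x (x ^+ 4) <= \int[P]_x (x ^+ 2 * weight (- be) x).
Proof.
move=> be0 i2 i4 E2; have al0 : - be <= 0 by lra.
have iw := sqr_weight_integrable _ al0 i2.
have [j4 J4] := Rint_scale (- be) (monom 4) i4.
have [k1 K1] := Rint_add _ _ i2 j4.
have -> : 1 - be * \int[P]_x x ^+ 4 = \int[P]_x (x ^+ 2 + - be * x ^+ 4).
  by rewrite K1 J4 E2 mulNr.
apply: le_Rintegral => // x _.
have := ler_wpM2l (sqr_ge0 x) (expRN_ge (be * x ^+ 2)).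
by rewrite /weight !mulNr (exprM x 2 2); lra.
Qed.

Lemma second_moment_le1 (al : R) : al <= 0 -> intP (monom 2) ->
  \int[P]_x (x ^+ 2) = 1 -> 0 <= \int[P]_x (x ^+ 2 * weight al x) <= 1.
Proof.
move=> al0 i2 E2; apply/andP; split.
  by apply: Rintegral_ge0 => x _; rewrite mulr_ge0 ?sqr_ge0// ltW// weight_gt0.
rewrite -[leRHS]E2; apply: le_Rintegral => //; first exact: sqr_weight_integrable.
by move=> x _; rewrite ler_piMr ?sqr_ge0// weight_le1.
Qed.

Lemma second_moment_le (be : R) : 0 <= be -> intP (monom 2) -> intP (monom 4) -> intP (monom 6) ->
  \int[P]_x (x ^+ 2) = 1 ->
  \int[P]_x (x ^+ 2 * weight (- be) x) <=
    1 - be * \int[P]_x (x ^+ 4) + be ^+ 2 * \int[P]_x (x ^+ 6).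
Proof.
move=> be0 i2 i4 i6 E2; have al0 : - be <= 0 by lra.
have iw := sqr_weight_integrable _ al0 i2.
have [j4 J4] := Rint_scale (- be) (monom 4) i4.
have [j6 J6] := Rint_scale (be ^+ 2) (monom 6) i6.
have [k1 K1] := Rint_add _ _ i2 j4.
have [k2 K2] := Rint_add _ _ k1 j6.
have bx x : 0 <= be * x ^+ 2 by rewrite mulr_ge0// sqr_ge0.
have -> : 1 - be * \int[P]_x x ^+ 4 + be ^+ 2 * \int[P]_x x ^+ 6 =
    \int[P]_x (x ^+ 2 + - be * x ^+ 4 + be ^+ 2 * x ^+ 6).
  by rewrite K2 K1 J4 J6 E2 mulNr.
apply: le_Rintegral => // x _.
have := ler_wpM2l (sqr_ge0 x) (expRN_le _ (bx x)).
rewrite /weight !mulNr (exprM x 2 2) (exprM x 2 3).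
by move: (x ^+ 2) => y; lra.
Qed.

End Reweighting.

Section GapArithmetic.
Context {R : realFieldType}.

(** The product of the lower bounds minus that of the upper bounds is [be (k - kh)], at least
    [be e / 20] because [k >= 1], minus at most [be^2 (k + 2 S)]; the cubic term [be^3 k kh] has the
    favorable sign. *)
Lemma reweighted_gap (e c S k kh N D Nh Dh : R) : 0 < e <= 1 / 3 -> 0 < c ->
  1 <= k <= 1 + S -> c * (1 + 3 * S) = 1 / 40 ->
  0 <= kh <= k * (1 - e / 20) -> 0 <= S ->
  let be := c * e ^+ 2 in
  1 - be <= D -> 0 <= Dh <= 1 - be + be ^+ 2 * kh ->
  1 - be * kh <= Nh -> 0 <= N <= 1 - be * k + be ^+ 2 * S ->
  c / 40 * e ^+ 3 <= Nh * D - N * Dh.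
Proof.
move=> /andP[e0 e3] c0 /andP[k1 kS] cS /andP[kh0 khk] S0 be hD /andP[Dh0 hDh] hNh /andP[N0 hN].
have e2 : 0 < e ^+ 2 <= e / 3 by apply/andP; split; nra.
have /andP[e20 e23] := e2.
have c1 : c <= 1 / 40 by nra.
have be0 : 0 < be by rewrite mulr_gt0.
have kk : kh <= k by nra.
have beS : be * (1 + 3 * S) = e ^+ 2 / 40 by rewrite /be -mulrA mulrCA -mulrA cS; ring.
have be1 : be <= 1 / 100 by nra.
have beSS : be * S <= 1 / 100 by nra.
have bek : be * k <= 1 / 10 by nra.
have bekh : be * kh <= 1 / 10 by nra.
have L : (1 - be * kh) * (1 - be) <= Nh * D by apply: ler_pM => //; lra.
have U : N * Dh <= (1 - be * k + be ^+ 2 * S) * (1 - be + be ^+ 2 * kh) by apply: ler_pM.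
have beg : be * (e / 20) <= be * (k - kh).
  by apply: ler_wpM2l; [exact: ltW|nra].
have Q1 : be ^+ 2 * k <= be * (be * (1 + S)) by rewrite expr2 -mulrA; apply: ler_wpM2l; [exact: ltW|apply: ler_wpM2l => //; exact: ltW].
have Q2 : be ^+ 2 * S * (1 - be + be ^+ 2 * kh) <= be * (be * (2 * S)).
  have h : 1 - be + be ^+ 2 * kh <= 2 by nra.
  have h' : 0 <= be ^+ 2 * S by rewrite mulr_ge0// sqr_ge0.
  by have := ler_wpM2l h' h; nra.
have Q3 : 0 <= be ^+ 3 * (k * kh).
  by apply: mulr_ge0; [exact/exprn_ge0/ltW|apply: mulr_ge0 => //; exact: le_trans k1].
have F : be * (e / 20) - be * (e ^+ 2 / 40) <= Nh * D - N * Dh.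
  rewrite -beS; nra.
apply: le_trans F.
have -> : c / 40 * e ^+ 3 = be * (e / 40) by rewrite /be; field.
by rewrite -mulrBr; apply: ler_wpM2l; [exact: ltW|lra].
Qed.

End GapArithmetic.

(** * The reweighted covariance matrix *)

Section DiagonalSpectrum.
Context {R : realType}.
Variables (n : nat) (M : 'M[R]_n.+2) (l1 l2 : R).
Hypotheses (l21 : l2 < l1)
  (ME : forall i j, M i j = if i == j then if i == ord0 then l1 else l2 else 0).

Lemma diag_top_two_eigenvalues : top_two_eigenvalues M l1 l2.
Proof.
exists (nseq n l2); split; last first.
  rewrite /= (ltW l21)/=; elim: n => //= m ->.
  by rewrite lexx.
have tM : is_trig_mx M.
  by apply/is_trig_mxP => i j ij; rewrite ME; case: eqP ij => // ->; rewrite ltnn.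
rewrite char_poly_trig// -[[:: l1, l2 & _]]/(l1 :: nseq n.+1 l2) big_cons.
rewrite big_ord_recl ME !eqxx; congr (_ * _).
rewrite big_nseq iter_mulr_1 -[in RHS](card_ord n.+1) -prodr_const.
by apply: eq_bigr => i _; rewrite ME !eqxx.
Qed.

Lemma mulmx_diagE (v : 'cV[R]_n.+2) i :
  (M *m v) i 0 = (if i == ord0 then l1 else l2) * v i 0.
Proof.
rewrite mxE (bigD1 i)//= ME eqxx big1 ?addr0// => j ji.
by rewrite ME eq_sym (negbTE ji) mul0r.
Qed.

Lemma enorm_sqr d (v : 'cV[R]_d) : enorm v ^+ 2 = \sum_i v i 0 ^+ 2.
Proof. by rewrite sqr_sqrtr// sumr_ge0// => i _; exact: sqr_ge0. Qed.

Lemma e1E (i : 'I_n.+2) : e1 n.+2 i 0 = (i == ord0)%:R :> R.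
Proof. by rewrite mxE. Qed.

Lemma diag_top_eigenvector (v : 'cV[R]_n.+2) :
  (M *m v = l1 *: v /\ enorm v = 1) <-> (v = e1 n.+2 \/ v = - e1 n.+2).
Proof.
have nE : enorm (e1 n.+2 : 'cV[R]_n.+2) = 1.
  rewrite /enorm big_ord_recl e1E eqxx big1 ?addr0 ?expr1n ?sqrtr1// => i _.
  by rewrite e1E expr0n.
have e1M : M *m e1 n.+2 = l1 *: e1 n.+2.
  apply/colP => i; rewrite mulmx_diagE [RHS]mxE !e1E.
  by case: eqP => // _; rewrite !mulr0.
split; last first.
  case=> ->; first by [].
  split; first by rewrite mulmxN e1M scalerN.
  by rewrite -nE /enorm; congr Num.sqrt; apply: eq_bigr => i _; rewrite mxE sqrrN.
move=> [Mv nv].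
have v0 i : i != ord0 -> v i 0 = 0.
  move=> i0; have := congr1 (fun u : 'cV[R]_n.+2 => u i 0) Mv.
  rewrite mulmx_diagE mxE (negbTE i0) => /eqP.
  rewrite -subr_eq0 -mulrBl mulf_eq0 subr_eq0 lt_eqF//=.
  by move/eqP.
have : v ord0 0 ^+ 2 = 1.
  have := enorm_sqr _ v; rewrite nv expr1n big_ord_recl big1 ?addr0// => i _.
  by rewrite v0// expr0n.
move/eqP; rewrite sqrf_eq1 => /orP[] /eqP vE; [left|right]; apply/colP => i.
  rewrite e1E; have [->//|i0] := eqVneq i ord0.
  exact: v0.
rewrite mxE e1E; have [->//|i0] := eqVneq i ord0.
by rewrite v0// oppr0.
Qed.

End DiagonalSpectrum.

(** * Expectation of a product of functions of the coordinates *)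

Section ProductExpectation.
Context {R : realType}.
Local Notation mR := (measurableTypeR R).

Definition tprod n (f : nat -> R -> R) (t : n.-tuple mR) : R :=
  \prod_(i < n) f i (tnth t i).

Lemma measurable_tprod n (f : nat -> R -> R) : (forall i, measurable_fun setT (f i)) ->
  measurable_fun setT (tprod n f).
Proof.
move=> mf; apply: measurable_prod => i _.
by apply: (measurableT_comp (mf i)); exact: (measurable_tnth i).
Qed.

Lemma tprod_bound n (f : nat -> R -> R) (B : R) : (forall i x, `|f i x| <= B) ->
  forall t, `|tprod n f t| <= B ^+ n.
Proof.
move=> fB t; rewrite normr_prod -[X in B ^+ X](card_ord n) -prodr_const.
by apply: ler_prod => i _; rewrite normr_ge0 fB.
Qed.

Lemma tprod_cons n (f : nat -> R -> R) z :
  tprod n.+1 f (tcons z) = f 0%N z.1 * tprod n (fun i => f i.+1) z.2.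
Proof.
rewrite /tprod big_ord_recl; congr (f 0%N _ * _).
by apply: eq_bigr => i _; congr (f _ _); rewrite !(tnth_nth 0).
Qed.

(** Fubini and induction on [n]; the uniform bound [B] provides integrability at each stage without
    any moment assumption on the laws. *)
Lemma Rintegral_prod_prob n (mu : nat -> probability mR R) (f : nat -> R -> R) (B : R) :
  (forall i, measurable_fun setT (f i)) -> (forall i x, `|f i x| <= B) ->
  \int[prod_prob n mu]_t tprod n f t = \prod_(i < n) \int[mu i]_x f i x.
Proof.
elim: n mu f => [|n IH] mu f mf fB.
  rewrite big_ord0 /Rintegral /= integral_dirac//.
    by rewrite diracT mul1e /tprod big_ord0.
  by apply/measurable_EFinP; exact: measurable_tprod.
rewrite big_ord_recl -(IH (fun i => mu i.+1) (fun i => f i.+1))//.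
set P' := prod_prob n _.
pose g (z : mR * n.-tuple mR) := f 0%N z.1 * tprod n (fun i => f i.+1) z.2.
have mg : measurable_fun setT g.
  apply: measurable_funM.
    by apply: (measurableT_comp (mf 0%N)); exact: measurable_fst.
  have mf' := measurable_tprod n (fun i => f i.+1) (fun i => mf i.+1).
  by apply: (measurableT_comp mf'); exact: measurable_snd.
have ig : (mu 0%N \x P')%E.-integrable setT (EFin \o g).
  apply: (@bounded_integrable _ _ _ _ g (B * B ^+ n)) => // z.
  rewrite /g normrM; apply: ler_pM; [exact: normr_ge0|exact: normr_ge0|exact: fB|].
  by apply: tprod_bound => i x; exact: fB.
have gE : (EFin \o tprod n.+1 f) \o @tcons R n = EFin \o g.
  by apply/funext => z; rewrite /= tprod_cons.
have mF : measurable_fun setT (EFin \o tprod n.+1 f).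
  by apply/measurable_EFinP; exact: measurable_tprod.
pose G := \int[P']_t tprod n (fun i => f i.+1) t.
have iG : P'.-integrable setT (EFin \o tprod n (fun i => f i.+1)).
  apply: (@bounded_integrable _ _ _ _ _ (B ^+ n)); first exact: measurable_tprod.
  by apply: tprod_bound => i x; exact: fB.
have if0 : (mu 0%N).-integrable setT (EFin \o f 0%N).
  exact: (@bounded_integrable _ _ _ (mu 0%N) (f 0%N) B (mf 0%N) (fB 0%N)).
have Eg x : (\int[P']_y (g (x, y))%:E = (f 0%N x * G)%:E)%E.
  rewrite /g /=; under eq_integral do rewrite EFinM.
  by rewrite integralZl// EFinM /G /Rintegral fineK//; exact: integrable_fin_num iG.
rewrite {1}/Rintegral [X in fine X](_ : _ = \int[mu 0%N \x P']_z (EFin \o g) z)%E; last first.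
  rewrite -gE -integral_distribution//; first by rewrite gE.
rewrite -(integral12_prod_meas1 ig) /fubini_F /=.
under eq_integral do rewrite Eg.
by rewrite -[LHS]/(\int[mu 0%N]_x (f 0%N x * G)) RintegralZr.
Qed.

End ProductExpectation.

Section ReweightedCovariance.
Context {R : realType}.
Local Notation mR := (measurableTypeR R).

(** The contribution of coordinate [k] to the entry [(i, j)]: the Gaussian weight splits over
    coordinates because the squared norm is a sum, and for [i = j = k] the two conditionals multiply
    to [x^2]. *)
Definition cov_factor (al : R) (i j k : nat) (x : R) : R :=
  weight al x * ((if k == i then x else 1) * (if k == j then x else 1)).

Lemma reweight_tprod (al : R) d (t : d.-tuple mR) (i j : 'I_d) :
  reweight al (col_of_tuple t) i j = tprod d (cov_factor al i j) t.
Proof.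
rewrite /reweight !mxE big_ord1 !mxE enorm_sqr /tprod !big_split /=.
have pick (l : 'I_d) : \prod_(k < d) (if val k == val l then tnth t k else 1) = tnth t l.
  rewrite (bigD1 l)//= eqxx big1 ?mulr1// => k kl.
  by rewrite (inj_eq val_inj) (negbTE kl).
rewrite !pick; congr (_ * _).
rewrite mulr_sumr expR_sum; apply: eq_bigr => k _.
by rewrite /weight mxE.
Qed.

Lemma measurable_cov_factor (al : R) (i j k : nat) :
  measurable_fun setT (cov_factor al i j k).
Proof.
apply: measurable_funM; first exact: measurable_weight.
by apply: measurable_funM; case: (_ == _).
Qed.

(** With [y = - al * x^2], the inequality [y <= e^y] bounds the weighted [x^2] by [1 / (- al)]. A
    negative [al] thus makes every factor bounded, whatever the law. *)
Lemma cov_factor_bound (al : R) : al < 0 -> forall (i j k : nat) x,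
  `|cov_factor al i j k x| <= 1 + (- al)^-1.
Proof.
move=> al0 i j k x; have w0 := weight_gt0 al x; have w1 := weight_le1 al x (ltW al0).
have be0 : 0 < - al by rewrite oppr_gt0.
rewrite normrM (gtr0_norm w0).
apply: (@le_trans _ _ (weight al x * (1 + x ^+ 2))).
  rewrite ler_wpM2l ?(ltW w0)//.
  have x2 : x ^+ 2 = `|x| ^+ 2 by rewrite real_normK ?num_real.
  have := normr_ge0 x; rewrite x2 normrM.
  by case: (k == i); case: (k == j); rewrite ?normr1; move: `|x| => u u0; nra.
rewrite mulrDr mulr1 lerD// -[leRHS]mul1r ler_pdivlMr//.
rewrite /weight -[al]opprK mulNr expRN -mulrA.
rewrite ler_pdivrMl ?expR_gt0// mulr1 opprK.
apply: le_trans (expR_ge1Dx _).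
by rewrite mulrC lerDr.
Qed.

Variables (Qhat Q : probability mR R) (n : nat) (al : R).
Hypotheses (al0 : al < 0) (Q_odd : forall f : R -> R, (forall x, f (- x) = - f x) ->
  measurable_fun setT f -> (exists M, forall x, `|f x| <= M) -> \int[Q]_x f x = 0).

Let M := reweighted_cov (prod_prob n.+2 (first_other Qhat Q)) al.
Local Notation Z P := (\int[P]_x weight al x).
Local Notation N P := (\int[P]_x (x ^+ 2 * weight al x)).

Lemma reweighted_covE i j : M i j =
  \prod_(k < n.+2) \int[first_other Qhat Q k]_x cov_factor al i j k x.
Proof.
rewrite mxE -(Rintegral_prod_prob _ _ _ (1 + (- al)^-1)).
- rewrite unlock /Rintegral; congr fine; apply: eq_integral => t _.
  by rewrite reweight_tprod.
- by move=> k; exact: measurable_cov_factor.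
- by move=> k x; apply: cov_factor_bound.
Qed.

Lemma reweighted_cov_offdiag i j : i != j -> M i j = 0.
Proof.
have Msym (k l : 'I_n.+2) : M k l = M l k.
  rewrite !reweighted_covE; apply: eq_bigr => m _; apply: eq_Rintegral => x _.
  by rewrite /cov_factor (mulrC (if _ then _ else _)).
(* The law [Qhat] need not be symmetric, so the vanishing odd factor is sought at a coordinate of
   law [Q]; one of two distinct indices is such. *)
wlog j0 : i j / j != ord0.
  move=> W ij; have [j0|j0] := eqVneq j ord0; last exact: (W i j j0 ij).
  by rewrite Msym; apply: W; rewrite -?j0// eq_sym.
move=> ij; rewrite reweighted_covE (bigD1 j)//=.
rewrite (_ : \int[_]_x _ = 0) ?mul0r//.
have -> : first_other Qhat Q j = Q by case: j j0 {ij} => [[]].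
apply: Q_odd.
- move=> x; rewrite /cov_factor eqxx (inj_eq val_inj) eq_sym (negbTE ij) !mul1r.
  by rewrite /weight sqrrN mulrN.
- exact: measurable_cov_factor.
- by exists (1 + (- al)^-1) => x; apply: cov_factor_bound.
Qed.

Lemma Rintegral_cov_factor (P : probability mR R) (i k : nat) :
  \int[P]_x cov_factor al i i k x = if k == i then N P else Z P.
Proof.
case: ifP => ki; apply: eq_Rintegral => x _; rewrite /cov_factor ki ?mulr1//.
by rewrite -expr2 mulrC.
Qed.

Lemma reweighted_cov00 : M ord0 ord0 = N Qhat * Z Q ^+ n.+1.
Proof.
rewrite reweighted_covE big_ord_recl Rintegral_cov_factor eqxx; congr (_ * _).
rewrite -[in RHS](card_ord n.+1) -prodr_const; apply: eq_bigr => k _.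
by rewrite Rintegral_cov_factor.
Qed.

Lemma reweighted_cov_diag i : i != ord0 -> M i i = Z Qhat * N Q * Z Q ^+ n.
Proof.
case: (unliftP ord0 i) => [i' ->|->]; last by rewrite eqxx.
move=> _; rewrite reweighted_covE big_ord_recl Rintegral_cov_factor -mulrA; congr (_ * _).
rewrite (bigD1 i')//= Rintegral_cov_factor eqxx; congr (_ * _).
rewrite (eq_bigr (fun _ => Z Q)) => [|k ki]; last first.
  rewrite Rintegral_cov_factor; case: eqP => // /eqP.
  by rewrite /= /bump !add1n eqSS (inj_eq (@ord_inj _)) (negbTE ki).
by rewrite prodr_const cardC1 card_ord.
Qed.

End ReweightedCovariance.

Theorem lemma9 (R : realType) :
  exists c3 C : R, [/\ 0 < c3, 0 < C &
  forall (eps : R) (q : R -> R) (Q : probability (measurableTypeR R) R)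
    (a b : R) (d : nat),
    0 < eps ->
    has_density Q q -> symmetric_density q -> isotropic Q -> logconcave q ->
    a < b ->
    (eps%:E <= Q `]-oo, a]%classic)%E ->
    (eps%:E <= Q `[a, b]%classic)%E ->
    (eps%:E <= Q `[b, +oo[%classic)%E ->
    (2 <= d)%N ->
    `|a + b| < eps ^+ 5 ->
    let Qhat := isotropize (remove_band Q a b) in
    let P := prod_prob d (first_other Qhat Q) in
    let alpha3 := - (c3 * eps ^+ 2) in
    let M := reweighted_cov P alpha3 in
    exists lambda1 lambda2 : R,
      [/\ top_two_eigenvalues M lambda1 lambda2,
          C * eps ^+ 3 * lambda1 <= lambda1 - lambda2 &
          forall v : 'cV[R]_d,
            (M *m v = lambda1 *: v /\ enorm v = 1) <->
            (v = e1 d \/ v = - e1 d)]].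
Proof.
have S0 : 0 <= sixth_bound :> R by exact: sixth_bound_ge0.
move: S0; set S : R := sixth_bound => S0; have SE : S = sixth_bound by [].
clearbody S.
have S1 : 0 < 1 + 3 * S by lra.
pose c := (40 * (1 + 3 * S))^-1; have c0 : 0 < c by rewrite invr_gt0 mulr_gt0.
have cS : c * (1 + 3 * S) = 1 / 40 by rewrite /c; field; rewrite gt_eqF.
exists c, (c / 40); split=> //; first by rewrite divr_gt0.
move=> e q Q a b [|[|n]]// e0 dq q_sym q_iso q_lc ab Qa Qab Qb _ abe Qhat P al M.
have e13 : 0 < e <= 1 / 3.
  by rewrite e0 (eps_le q Q dq q_sym e a b ab Qa Qab Qb).
have [h2 h4 H2 H4] := hat_moments q Q dq q_sym q_iso q_lc e a b e0 ab Qa Qab Qb abe.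
have DM k (k6 : (k <= 6)%N) := density_moment q Q dq q_sym q_iso q_lc k k6.
have [i2 E2] := DM 2 isT; have [i4 E4] := DM 4 isT; have [i6 E6] := DM 6 isT.
have e2 : 0 < e ^+ 2 by rewrite exprn_gt0.
have be0 : 0 < c * e ^+ 2 by rewrite mulr_gt0.
have al0 : al < 0 by rewrite oppr_lt0.
have Q2 : \int[Q]_x (x ^+ 2) = 1 by rewrite E2; have [] := isotropic_sqr q Q dq q_iso.
have [k1 kS] := fourth_moment_bounds Q i2 i4 i6 Q2.
have S6 : \int[Q]_x (x ^+ 6) <= S.
  by rewrite E6 SE; exact: (density_sixth q Q dq q_sym q_iso q_lc).
have alE : al = - (c * e ^+ 2) by [].
set D := \int[Q]_x weight al x; set N := \int[Q]_x (x ^+ 2 * weight al x).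
set Dh := \int[Qhat]_x weight al x; set Nh := \int[Qhat]_x (x ^+ 2 * weight al x).
have [/andP[D1 D2] D3] := partition_bounds Q _ (ltW be0) i2 i4 Q2.
have [/andP[Dh1 Dh2] Dh3] := partition_bounds Qhat _ (ltW be0) h2 h4 H2.
have Nh1 := second_moment_ge Qhat _ (ltW be0) h2 h4 H2.
have /andP[Nh2 Nh3] := second_moment_le1 Qhat al (ltW al0) h2 H2.
have /andP[N2 N3] := second_moment_le1 Q al (ltW al0) i2 Q2.
have N1 := second_moment_le Q _ (ltW be0) i2 i4 i6 Q2.
rewrite -alE -/D -/Dh -/Nh -/N in D1 D2 D3 Dh1 Dh2 Dh3 Nh1 Nh2 Nh3 N1 N2 N3.
have c40 : c <= 1 / 40.
  have : 0 <= c * (3 * S) by rewrite !mulr_ge0// ltW.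
  by clear -cS; move: cS; rewrite mulrDr mulr1; lra.
have be1 : c * e ^+ 2 <= 1 / 40.
  have /andP[_ e3] := e13.
  rewrite -[leRHS]mulr1; apply: ler_pM; [exact: ltW|exact: ltW|exact: c40|].
  by rewrite expr_le1 ?(ltW e0)//; clear -e3; lra.
have D0 : 0 < D by clear -D1 be1 alE; lra.
have G : c / 40 * e ^+ 3 <= Nh * D - N * Dh.
  apply: (reweighted_gap e c S (\int[Q]_x (x ^+ 4)) (\int[Qhat]_x (x ^+ 4))) => //.
  - by apply/andP; split=> //; apply: (le_trans kS); rewrite lerD2l.
  - apply/andP; split=> //; apply: Rintegral_ge0 => x _; exact: exprn_even_ge0.
  - by apply/andP; split=> //; clear -Dh1 be1 alE; lra.
  - rewrite N2/=; apply: (le_trans N1); rewrite lerD2l.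
    by apply: ler_wpM2l => //; exact: sqr_ge0.
have Dn : 0 < D ^+ n by rewrite exprn_gt0.
have c3 : 0 < c / 40 * e ^+ 3 by rewrite mulr_gt0 ?exprn_gt0 ?divr_gt0.
have l12 : Nh * D ^+ n.+1 - Dh * N * D ^+ n = D ^+ n * (Nh * D - N * Dh).
  by rewrite exprS; ring.
have lt12 : Dh * N * D ^+ n < Nh * D ^+ n.+1.
  by rewrite -subr_gt0 l12 mulr_gt0//; exact: lt_le_trans G.
have Qodd := density_odd q Q dq q_sym.
have ME i j : M i j = if i == j then
    if i == ord0 then Nh * D ^+ n.+1 else Dh * N * D ^+ n else 0.
  have [<-|ij] := eqVneq i j; last exact: reweighted_cov_offdiag.
  have [->|i0] := eqVneq i ord0; first exact: reweighted_cov00.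
  exact: reweighted_cov_diag.
exists (Nh * D ^+ n.+1), (Dh * N * D ^+ n); split.
- exact: diag_top_two_eigenvalues.
(* The larger eigenvalue is [D ^+ n * (Nh * D)] with [Nh * D <= 1], so the absolute gap [G] already
   implies the relative one, uniformly in the dimension. *)
- rewrite l12 (_ : _ * (Nh * _) = D ^+ n * (c / 40 * e ^+ 3 * (Nh * D))); last first.
    by rewrite (exprS D n); ring.
  apply: ler_wpM2l; first exact: ltW.
  apply: le_trans G; rewrite ler_piMr ?(ltW c3)//.
  by rewrite -[leRHS]mulr1; apply: ler_pM => //; exact: ltW.
- by move=> v; apply: (diag_top_eigenvector _ _ _ _ lt12).
Qed.
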